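(* Let $A\subseteq[0,1]$ be an infinite compact set containing $0$ and $1$ and closed under $\min$ and $\max$, and let $\neg\colon A\to A$ be a continuous operation such that, in $\mathbf{A}=\langle A,\wedge,\vee,\neg\rangle$ (with $\wedge=\min$, $\vee=\max$): (1) $\neg(v\wedge w)=\neg v\vee\neg w$ and $\neg(v\vee w)=\neg v\wedge\neg w$; (2) $v\le\neg\neg v$; (3) $\neg1=0$. Then $\mathcal{L}^{\mathbf{A}}$ satisfies the zero-one law (for every sentence $\varphi$ there is a unique $a\in A$ with $\lim_{n\to\infty}\mu_n(\varphi\in V)=1$ for every open set $V$ containing $a$), and its only almost sure values are $0$, $1$, $\varepsilon=\sup_{x\in A}(x\wedge\neg x)$, $\varepsilon'=\sup_{x\in A}(\neg x\wedge\neg\neg x)$, $\delta=\inf_{x\in A}(x\vee\neg x)$, and $\delta'=\inf_{x\in A}(\neg x\vee\neg\neg x)$.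
   Context: For a finite relational vocabulary $\tau$, formulas of $\mathcal{L}^{\mathbf{A}}(\tau)$ are built from atomic formulas $R(x_1,\dots,x_{\tau(R)})$ with connectives $\wedge,\vee,\neg$ and quantifiers $\forall,\exists$, evaluated in structures $\mathfrak{M}$ (nonempty domain $M$, maps $R^{\mathfrak{M}}\colon M^{\tau(R)}\to A$) via the operations of $\mathbf{A}$, with $\forall$ as infimum and $\exists$ as supremum. For each $R\in\tau$, $p_R$ is a Borel probability measure on $A$ giving positive measure to every nonempty relatively open subset of $A$; structures with domain $[n]=\{1,\dots,n\}$ form the space $\prod_{R\in\tau}A^{[n]^{\tau(R)}}$ with the product measure $\rho_n$, and $\mu_n(\varphi\in S)=\rho_n\{\mathfrak{M}:\|\varphi\|^{\mathfrak{M}}\in S\}$. An element $a\in A$ is an almost sure value if some sentence $\varphi$ satisfies $\lim_n\mu_n(\varphi\in V)=1$ for every open $V\ni a$.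
   Formalization: All relation symbols are assumed to have positive arity (for a nullary R the sentence R() has the non-degenerate law p_R for every n, so the law fails), and that each listed value is an almost sure value is claimed only for a nonempty vocabulary (the empty one has no sentences). *)

(* Defs.v *)
From HB Require Import structures.
From mathcomp Require Import all_boot all_order all_algebra.
From mathcomp Require Import all_classical all_reals all_analysis.

Set Implicit Arguments.
Unset Strict Implicit.
Unset Printing Implicit Defensive.

Import Order.TTheory GRing.Theory Num.Theory.
Import numFieldNormedType.Exports.

Local Open Scope classical_set_scope.
Local Open Scope ring_scope.

Section product_probability.
Local Open Scope ereal_scope.
Context d (T : measurableType d) (R : realType).

Definition tcons n (xt : T * n.-tuple T) : n.+1.-tuple T :=
  [tuple of xt.1 :: xt.2].

Lemma measurable_tcons n : measurable_fun [set: T * n.-tuple T] (@tcons n).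
Proof. exact: measurable_cons. Qed.

HB.instance Definition _ n :=
  isMeasurableFun.Build _ _ _ _ (@tcons n) (@measurable_tcons n).

(* The finite product P_0 x ... x P_(n-1), as a probability on the product
   sigma-algebra of n.-tuple T; product_probability_rect is its
   characterization on measurable rectangles. *)
Fixpoint product_probability n :
    ('I_n -> probability T R) -> probability (n.-tuple T) R :=
  match n with
  | 0 => fun _ => \d_([tuple])
  | m.+1 => fun P => distribution
      (P ord0 \x product_probability (fun i => P (lift ord0 i))) (@tcons m)
  end.

Lemma product_probability_rect n (P : 'I_n -> probability T R)
    (B : 'I_n -> set T) : (forall i, measurable (B i)) ->
  product_probability P [set t | forall i, B i (tnth t i)]
  = \prod_(i < n) P i (B i).
Proof.
elim: n P B => [|n IH] P B mB /=.
  by rewrite big_ord0 diracE mem_set//= => -[].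
rewrite big_ord_recl -IH// -product_measure1E//; last first.
  rewrite (_ : [set _ | _] = \big[setI/setT]_(i < n)
      ((fun t : n.-tuple T => tnth t i) @^-1` B (lift ord0 i))).
    apply: bigsetI_measurable => i _.
    by rewrite -[X in measurable X]setTI; exact: measurable_tnth.
  rewrite -bigcap_seq; apply/seteqP; split=> t /= tB i.
    by move=> _; exact: tB.
  by apply: tB; rewrite /= mem_index_enum.
rewrite /distribution /pushforward; congr (product_measure1 _ _ _).
apply/seteqP; split=> -[x t] /=.
  move=> xtB; split=> [|i]; first exact: (xtB ord0).
  by have := xtB (lift ord0 i); rewrite tnthS.
move=> [xB tB] i; case: (unliftP ord0 i) => [j|] ->; last exact: xB.
by rewrite tnthS.
Qed.

End product_probability.

Section logic.
Context (R : realType) (Rel : finType) (ar : Rel -> nat).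

Inductive formula :=
| Atom (r : Rel) of (ar r).-tuple nat
| And of formula & formula
| Or of formula & formula
| Neg of formula
| Forall of nat & formula
| Exists of nat & formula.

Fixpoint free_vars (f : formula) : seq nat :=
  match f with
  | Atom _ xs => xs
  | And f g | Or f g => free_vars f ++ free_vars g
  | Neg f => free_vars f
  | Forall x f | Exists x f => [seq y <- free_vars f | y != x]
  end.

Definition sentence (f : formula) : Prop := free_vars f = [::].

Definition interpretation (D : Type) : Type :=
  forall r : Rel, (ar r).-tuple D -> R.

Definition update (D : Type) (v : nat -> D) (x : nat) (a : D) : nat -> D :=
  fun y => if y == x then a else v y.

Fixpoint value (neg : R -> R) (D : Type) (M : interpretation D)
    (v : nat -> D) (f : formula) : R :=
  match f with
  | Atom r xs => M r (map_tuple v xs)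
  | And f g => Num.min (value neg M v f) (value neg M v g)
  | Or f g => Num.max (value neg M v f) (value neg M v g)
  | Neg f => neg (value neg M v f)
  | Forall x f => inf (range (fun a => value neg M (update v x a) f))
  | Exists x f => sup (range (fun a => value neg M (update v x a) f))
  end.

Definition atom_index (n : nat) : finType := {r : Rel & (ar r).-tuple 'I_n}.

(* A point of R^(atom_index n), its coordinates listed along the enumeration
   of atom_index n, read as an interpretation with domain 'I_n. *)
Definition interp_of n (w : #|atom_index n|.-tuple R) : interpretation 'I_n :=
  fun r xs => tnth w (enum_rank (existT _ r xs : atom_index n)).

Definition rho (p : Rel -> probability R R) n :
    probability (#|atom_index n|.-tuple R) R :=
  product_probability (fun i => p (tag (enum_val i : atom_index n))).

(* mu A neg p n phi S is the probability that phi takes a value in S in a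
   random structure with domain of size n.+1, so that domains are nonempty.
   Each p r is carried by A, hence rho by the A-valued interpretations; the
   intersection with the latter makes the event independent of the behaviour
   of neg outside A.  The assignment is irrelevant when phi is a sentence. *)
Definition mu (A : set R) (neg : R -> R) (p : Rel -> probability R R)
    (n : nat) (phi : formula) (S : set R) : \bar R :=
  rho p n.+1 [set w | (forall i, A (tnth w i)) /\
                      S (value neg (interp_of w) (fun=> ord0) phi)].

Definition almost_surely (A : set R) (neg : R -> R)
    (p : Rel -> probability R R) (phi : formula) (a : R) : Prop :=
  forall V : set R, open V -> V a ->
    mu A neg p n phi V @[n --> \oo] --> 1%E.

Definition zero_one_law (A : set R) (neg : R -> R)
    (p : Rel -> probability R R) : Prop :=
  forall phi, sentence phi ->
    exists! a, A a /\ almost_surely A neg p phi a.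

Definition almost_sure_value (A : set R) (neg : R -> R)
    (p : Rel -> probability R R) (a : R) : Prop :=
  A a /\ exists2 phi, sentence phi & almost_surely A neg p phi a.

End logic.

(* Main.v *)
Require Import Defs.
From HB Require Import structures.
From mathcomp Require Import all_boot all_order all_algebra.
From mathcomp Require Import all_classical all_reals all_analysis.
From mathcomp Require Import measurable_realfun ring lra.
Import Order.TTheory GRing.Theory Num.Theory.
Import numFieldNormedType.Exports.

Local Open Scope classical_set_scope.
Local Open Scope ring_scope.

Set Implicit Arguments.
Unset Strict Implicit.
Unset Printing Implicit Defensive.

(** Zero-one laws say that a filter decides every sentence; here the filter is
    the one of the properties whose probability tends to 1.  It contains the
    extension axioms: over any [k] distinct points some new point has its atoms
    close to prescribed values.  The candidates for the new point are
    independent, so such an axiom fails with at most [n ^ k] times a geometric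
    probability.

    Along any filter containing the extension axioms, quantifiers can be
    eliminated approximately.  By the De Morgan laws and
    [neg (neg (neg x)) = neg x], a quantifier-free formula is a lattice term in
    the literals [x], [neg x], [neg (neg x)] of its atoms.  In disjunctive
    normal form, its supremum over the atoms of a new point can be taken clause
    by clause and, the atoms being independent variables, atom by atom; this
    only produces the constants [1], [epsilon], [epsilon'], and dually [0],
    [delta], [delta'], a set closed under [neg].  The suprema are attained,
    hence nearly realized by the extension axioms, so a sentence converges to a
    lattice term without atoms, that is, to one of the six constants. *)

(** * Uniform continuity *)

Section uniform_continuity.
Context {R : realType}.

Definition unif_continuous_on (V W : pseudoMetricNormedZmodType R) (A : set V)
    (f : V -> W) := forall e : R, 0 < e -> exists2 d : R, 0 < d &
  forall x y, A x -> A y -> `|x - y| < d -> `|f x - f y| < e.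

Lemma compact_unif_continuous_on (V W : pseudoMetricNormedZmodType R)
    (A : set V) (f : V -> W) :
  compact A -> {within A, continuous f} -> unif_continuous_on A f.
Proof.
move=> /compact_near_coveringP cA /subspace_continuousP cf e e0.
case: (cA _ (0 : R)^'+ (fun d x => A x ->
    forall y, A y -> `|x - y| < d -> `|f x - f y| < e) _) => [x Ax|d /= d0 dP].
  move: (cf _ Ax) => /cvgrPdist_lt/(_ (e / 2)).
  rewrite divr_gt0// => /(_ isT)/nbhs_ballP[r /= r0 rP].
  have r20 : 0 < r / 2 by rewrite divr_gt0.
  exists (ball x (r / 2), [set t | t < r / 2]).
    by split; [exact: nbhsx_ballx|exact: nbhs_right_lt].
  move=> [x' t] [/=]; rewrite -ball_normE /= => xx' tr Ax' y Ay x'y.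
  have fxx' : `|f x - f x'| < e / 2 by apply: rP; rewrite -?ball_normE//=; lra.
  have fxy : `|f x - f y| < e / 2.
    apply: rP; rewrite -?ball_normE//=.
    by rewrite (le_lt_trans (ler_distD x' _ _))//; lra.
  by rewrite (le_lt_trans (ler_distD (f x) _ _))// distrC; lra.
have d20 : 0 < d / 2 by rewrite divr_gt0.
exists (d / 2) => // x y Ax Ay xy; apply: (dP (d / 2)) => //=.
by rewrite sub0r normrN gtr0_norm//; lra.
Qed.

Lemma unif_continuous_on_within (V W : pseudoMetricNormedZmodType R)
    (A : set V) (f : V -> W) :
  unif_continuous_on A f -> {within A, continuous f}.
Proof.
move=> uf; apply/subspace_continuousP => x Ax; apply/cvgrPdist_lt => e.
move=> /uf[d d0 dP]; apply/nbhs_ballP; exists d => //= y.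
by rewrite -ball_normE /= => xy Ay; exact: dP.
Qed.

Lemma unif_continuous_on_id (V : pseudoMetricNormedZmodType R) (A : set V) :
  unif_continuous_on A id.
Proof. by move=> e e0; exists e. Qed.

Lemma unif_continuous_on_comp (U V W : pseudoMetricNormedZmodType R)
    (A : set U) (B : set V) (g : U -> V) (f : V -> W) :
  (forall x, A x -> B (g x)) ->
  unif_continuous_on B f -> unif_continuous_on A g ->
  unif_continuous_on A (f \o g).
Proof.
move=> AB uf ug e /uf[d /ug[d' d'0 gP] fP].
by exists d' => // x y Ax Ay xy; apply: fP; [exact: AB..|exact: gP].
Qed.

Lemma unif_continuous_onN (V W : pseudoMetricNormedZmodType R) (A : set V)
    (f : V -> W) :
  unif_continuous_on A f -> unif_continuous_on A (fun x => - f x).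
Proof.
move=> uf e /uf[d d0 dP]; exists d => // x y Ax Ay xy.
by rewrite -opprD normrN; exact: dP.
Qed.

Lemma dist_min_le (x x' y y' : R) :
  `|Num.min x y - Num.min x' y'| <= Num.max `|x - x'| `|y - y'|.
Proof.
set m := Num.max _ _.
have : `|x - x'| <= m by rewrite le_max lexx.
have : `|y - y'| <= m by rewrite le_max lexx orbT.
rewrite !ler_distl => /andP[? ?] /andP[? ?].
by have [?|?] := leP x y; have [?|?] := leP x' y'; apply/andP; split; lra.
Qed.

Lemma dist_max_le (x x' y y' : R) :
  `|Num.max x y - Num.max x' y'| <= Num.max `|x - x'| `|y - y'|.
Proof.
rewrite -[Num.max x y]opprK -[Num.max x' y']opprK !oppr_max -opprD normrN.
by rewrite (le_trans (dist_min_le _ _ _ _))// -!opprD !normrN.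
Qed.

Lemma unif_continuous_on_min (V : pseudoMetricNormedZmodType R) (A : set V)
    (f g : V -> R) : unif_continuous_on A f -> unif_continuous_on A g ->
  unif_continuous_on A (fun x => Num.min (f x) (g x)).
Proof.
move=> uf ug e e0; have [d d0 fP] := uf _ e0; have [d' d'0 gP] := ug _ e0.
exists (Num.min d d') => [|x y Ax Ay]; first by rewrite lt_min d0.
rewrite lt_min => /andP[xyd xyd'].
by rewrite (le_lt_trans (dist_min_le _ _ _ _))// gt_max fP// gP.
Qed.

Lemma unif_continuous_on_max (V : pseudoMetricNormedZmodType R) (A : set V)
    (f g : V -> R) : unif_continuous_on A f -> unif_continuous_on A g ->
  unif_continuous_on A (fun x => Num.max (f x) (g x)).
Proof.
move=> uf ug; rewrite (_ : (fun x => _) =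
    (fun x => - Num.min (- f x) (- g x))).
  apply/unif_continuous_onN/unif_continuous_on_min;
    exact: unif_continuous_onN.
by apply/funext => x; rewrite -oppr_max opprK.
Qed.

End uniform_continuity.

(** * Lattice terms *)

Section bigmin.
Context {d : Order.disp_t} {T : orderType d} {I : Type}.

Lemma le_bigmin_seqE (x c : T) (s : seq I) (P : pred I) (F : I -> T) :
  (x <= \big[Order.min/c]_(i <- s | P i) F i)%O =
  (x <= c)%O && all (fun i => P i ==> (x <= F i)%O) s.
Proof.
elim: s => [|i s IH]; first by rewrite big_nil andbT.
by rewrite big_cons /=; case: (P i); rewrite ?le_min IH// andbCA.
Qed.

End bigmin.

Section lattice_terms.
Context {R : realType} {I J : eqType}.
Implicit Types (A K : set R) (G : J -> R -> R) (P : pred I).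
Implicit Types (f g : (I -> R) -> R) (w u : I -> R) (s t : seq (J * I)).

Definition valued A w := forall i, A (w i).

(* In the application, [G j] is the [j]-th iterate of the negation. *)
Inductive lterm K G P : ((I -> R) -> R) -> Prop :=
| lterm_cst c : K c -> lterm K G P (fun=> c)
| lterm_lit j i : P i -> lterm K G P (fun w => G j (w i))
| lterm_min f g : lterm K G P f -> lterm K G P g ->
    lterm K G P (fun w => Num.min (f w) (g w))
| lterm_max f g : lterm K G P f -> lterm K G P g ->
    lterm K G P (fun w => Num.max (f w) (g w)).

Lemma lterm_bigmin K G P c (T : Type) (r : seq T) (F : T -> (I -> R) -> R) :
  K c -> (forall x, lterm K G P (F x)) ->
  lterm K G P (fun w => \big[Num.min/c]_(x <- r) F x w).
Proof.
move=> Kc KF; elim: r => [|x r IH].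
  by under eq_fun do rewrite big_nil; exact: lterm_cst.
by under eq_fun do rewrite big_cons; exact: lterm_min.
Qed.

Lemma lterm_opp K G P f : lterm K G P f ->
  lterm (-%R @` K) (fun j x => - G j x) P (fun w => - f w).
Proof.
elim=> [c Kc|j i Pi|{}f g _ IHf _ IHg|{}f g _ IHf _ IHg].
- by apply: lterm_cst; exists c.
- exact: (@lterm_lit _ (fun j x => - G j x)).
- have -> : (fun w => - Num.min (f w) (g w)) =
    (fun w => Num.max (- f w) (- g w)).
    by apply/funext => w; rewrite oppr_min.
  exact: lterm_max.
- have -> : (fun w => - Num.max (f w) (g w)) =
    (fun w => Num.min (- f w) (- g w)).
    by apply/funext => w; rewrite oppr_max.
  exact: lterm_min.
Qed.

Lemma lterm_valued A K G P f w : K `<=` A ->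
  (forall j x, A x -> A (G j x)) -> lterm K G P f -> valued A w -> A (f w).
Proof.
move=> KA GA + Aw; elim=> [c /KA//|j i _|{}f g _ IHf _ IHg|{}f g _ IHf _ IHg].
- exact: GA.
- by case: leP.
- by case: leP.
Qed.

Lemma lterm_neg A K G P (neg : R -> R) (succ : J -> J) f :
  K `<=` A -> (forall c, K c -> K (neg c)) ->
  (forall j x, A x -> A (G j x)) -> (forall j x, neg (G j x) = G (succ j) x) ->
  (forall x y, A x -> A y -> neg (Num.min x y) = Num.max (neg x) (neg y)) ->
  (forall x y, A x -> A y -> neg (Num.max x y) = Num.min (neg x) (neg y)) ->
  lterm K G P f ->
  exists2 g, lterm K G P g & forall w, valued A w -> g w = neg (f w).
Proof.
move=> KA Kneg GA Gneg neg_min neg_max.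
have fA h w : lterm K G P h -> valued A w -> A (h w) by exact: lterm_valued.
elim=> [c Kc|j i Pi|f1 f2 Kf1 [g1 Kg1 g1E] Kf2 [g2 Kg2 g2E]
               |f1 f2 Kf1 [g1 Kg1 g1E] Kf2 [g2 Kg2 g2E]].
- by exists (fun=> neg c) => //; exact/lterm_cst/Kneg.
- by exists (fun w => G (succ j) (w i)) => //; exact: lterm_lit.
- exists (fun w => Num.max (g1 w) (g2 w)); first exact: lterm_max.
  by move=> w Aw; rewrite g1E// g2E// neg_min//; exact: fA.
- exists (fun w => Num.min (g1 w) (g2 w)); first exact: lterm_min.
  by move=> w Aw; rewrite g1E// g2E// neg_max//; exact: fA.
Qed.

Lemma lterm_eq_in K G P f w w' :
  lterm K G P f -> {in P, w =1 w'} -> f w = f w'.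
Proof.
by move=> + ww'; elim=> [//|j i /ww' ->//|{}f g _ -> _ ->//|{}f g _ -> _ ->].
Qed.

Lemma lterm_pred0 K G P f : P =1 pred0 -> lterm K G P f ->
  exists2 c, K c & f = fun=> c.
Proof.
move=> P0; elim=> [c Kc|j i|{}f g _ [c Kc ->] _ [d Kd ->]
                           |{}f g _ [c Kc ->] _ [d Kd ->]].
- by exists c.
- by rewrite P0.
- by exists (Num.min c d) => //; case: leP.
- by exists (Num.max c d) => //; case: leP.
Qed.

Lemma lterm_unif_continuous A K G P f :
  (forall j, unif_continuous_on A (G j)) -> lterm K G P f ->
  forall e : R, 0 < e -> exists2 d : R, 0 < d &
    forall w w', valued A w -> valued A w' ->
      {in P, forall i, `|w i - w' i| < d} -> `|f w - f w'| < e.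
Proof.
move=> uG Kf e e0; elim: Kf => [c _|j i Pi|{}f g _ [d d0 fP] _ [d' d'0 gP]
                                 |{}f g _ [d d0 fP] _ [d' d'0 gP]].
- by exists 1 => // w w' _ _ _; rewrite subrr normr0.
- have [d d0 GP] := uG j _ e0; exists d => // w w' Aw Aw' ww'.
  by apply: GP => //; exact: ww'.
- exists (Num.min d d') => [|w w' Aw Aw' ww']; first by rewrite lt_min d0.
  rewrite (le_lt_trans (dist_min_le _ _ _ _))// gt_max fP ?gP// => i /ww'.
    by rewrite lt_min => /andP[].
  by rewrite lt_min => /andP[].
- exists (Num.min d d') => [|w w' Aw Aw' ww']; first by rewrite lt_min d0.
  rewrite (le_lt_trans (dist_max_le _ _ _ _))// gt_max fP ?gP// => i /ww'.
    by rewrite lt_min => /andP[].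
  by rewrite lt_min => /andP[].
Qed.

Definition clause G c s w : R := \big[Num.min/c]_(l <- s) G l.1 (w l.2).

Lemma clause_cat G c d s t w :
  clause G (Num.min c d) (s ++ t) w = Num.min (clause G c s w) (clause G d t w).
Proof.
have leE x : (x <= clause G (Num.min c d) (s ++ t) w) =
    (x <= Num.min (clause G c s w) (clause G d t w)).
  by rewrite le_min /clause !le_bigmin_seqE all_cat le_min andbACA.
by apply/le_anti; rewrite -leE lexx leE lexx.
Qed.

Inductive dnf A K G f : Prop :=
| dnf_clause c s of K c &
    (forall w, valued A w -> f w = clause G c s w)
| dnf_max g h of dnf A K G g & dnf A K G h &
    (forall w, valued A w -> f w = Num.max (g w) (h w)).

Lemma dnf_min A K G f g : dnf A K G f -> dnf A K G g ->
  dnf A K G (fun w => Num.min (f w) (g w)).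
Proof.
move=> + Dg; elim=> {}f.
  move=> c s Kc fE; elim: Dg => {}g.
    move=> d t Kd gE; apply: (@dnf_clause _ _ _ _ (Num.min c d) (s ++ t)).
      by case: leP.
    by move=> w Aw; rewrite clause_cat fE// gE.
  move=> g1 g2 _ IH1 _ IH2 gE; apply: (dnf_max IH1 IH2) => w Aw.
  by rewrite gE// min_maxr.
move=> f1 f2 _ IH1 _ IH2 fE; apply: (dnf_max IH1 IH2) => w Aw.
by rewrite fE// min_maxl.
Qed.

Lemma lterm_dnf A K G P f (top : R) : K top ->
  (forall j x, A x -> G j x <= top) -> lterm K G P f -> dnf A K G f.
Proof.
move=> Ktop Gtop; elim=> [c Kc|j i Pi|{}f g _ IHf _ IHg|{}f g _ IHf _ IHg].
- by apply: (@dnf_clause _ _ _ _ c [::]) => // w _; rewrite /clause big_nil.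
- apply: (@dnf_clause _ _ _ _ top [:: (j, i)]) => // w Aw.
  by rewrite /clause big_cons big_nil; apply/esym/min_idPl/Gtop.
- exact: dnf_min.
- exact: (dnf_max IHf IHg).
Qed.

Definition meet_attained A K G (js : seq J) := forall c, K c ->
  exists u : R, [/\ A u, K (\big[Num.min/c]_(j <- js) G j u) &
    forall x, A x -> \big[Num.min/c]_(j <- js) G j x <=
                     \big[Num.min/c]_(j <- js) G j u].

Lemma meet_attained_top A K G js (top u : R) : (forall c, K c -> c <= top) ->
  A u -> {in js, forall j, G j u = top} -> meet_attained A K G js.
Proof.
move=> Ktop Au Gu c Kc; exists u.
have -> : \big[Num.min/c]_(j <- js) G j u = c.
  apply/le_anti; rewrite bigmin_le_id le_bigmin_seqE lexx /=.
  by apply/allP => j /Gu /= ->; exact: Ktop.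
by split=> // x _; exact: bigmin_le_id.
Qed.

Lemma meet_attained_pair A K G js i k (u : R) : i \in js -> k \in js ->
  (forall x, A x -> {in js, forall j, Num.min (G i x) (G k x) <= G j x}) ->
  A u -> K (Num.min (G i u) (G k u)) ->
  (forall x, A x -> Num.min (G i x) (G k x) <= Num.min (G i u) (G k u)) ->
  meet_attained A K G js.
Proof.
move=> ijs kjs le_js Au Ku umax c Kc.
have bigE x : A x -> \big[Num.min/c]_(j <- js) G j x =
    Num.min c (Num.min (G i x) (G k x)).
  move=> Ax; apply/le_anti; rewrite !le_min bigmin_le_id !ge_bigmin_seq//=.
  rewrite le_bigmin_seqE ge_min lexx /=; apply/allP => j jjs.
  by rewrite /= ge_min le_js ?orbT.
exists u; rewrite bigE//; split=> // [|x Ax]; first by case: leP.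
by rewrite bigE// le_min ge_min lexx /= ge_min umax// orbT.
Qed.

Definition splice P w u : I -> R := fun i => if P i then w i else u i.

Lemma splice_valued A P w u :
  valued A w -> valued A u -> valued A (splice P w u).
Proof. by move=> Aw Au i; rewrite /splice; case: ifP. Qed.

(* [g w] is the maximum of [f] over the points agreeing with [w] on [P]; it is
   reached at one of finitely many choices, not depending on [w], of the other
   coordinates. *)
Definition fiber_max A P f g :=
  (forall w, valued A w -> f w <= g w) /\
  exists (T : finType) (u : T -> I -> R), (forall x, valued A (u x)) /\
    forall w, valued A w -> exists x, g w <= f (splice P w (u x)).

Lemma eq_fiber_max A P f f' g : (forall w, valued A w -> f w = f' w) ->
  fiber_max A P f' g -> fiber_max A P f g.
Proof.
move=> ff' [le_fg [T [u [Au gE]]]].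
split=> [w Aw|]; first by rewrite ff'// le_fg.
exists T, u; split=> // w Aw; have [x gx] := gE w Aw; exists x.
by rewrite ff'//; exact: splice_valued.
Qed.

Lemma clause_fiber_max A K G P c s :
  (forall js, meet_attained A K G js) -> K c ->
  exists2 g, lterm K G P g & fiber_max A P (clause G c s) g.
Proof.
move=> att Kc.
have /choice[u uP] i := att [seq l.1 | l <- s & l.2 == i] c Kc.
pose kappa i := \big[Num.min/c]_(l <- s | l.2 == i) G l.1 (u i).
have kappaE i x : \big[Num.min/c]_(j <- [seq l.1 | l <- s & l.2 == i]) G j x =
    \big[Num.min/c]_(l <- s | l.2 == i) G l.1 x.
  by rewrite big_map big_filter.
pose g w := \big[Num.min/c]_(l <- s) if P l.2 then G l.1 (w l.2) else kappa l.2.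
have Au i : A (u i) by have [] := uP i.
have le_kappa i x : A x ->
    \big[Num.min/c]_(l <- s | l.2 == i) G l.1 x <= kappa i.
  by rewrite /kappa -!kappaE; have [_ _] := uP i; exact.
have le_fg w : valued A w -> clause G c s w <= g w.
  move=> Aw; have := lexx (clause G c s w).
  rewrite {2}/clause /g !le_bigmin_seqE => /andP[-> /allP le_lit] /=.
  apply/allP => l ls /=; case: ifP => _; first exact: le_lit.
  apply: le_trans (le_kappa _ _ (Aw l.2)); rewrite le_bigmin_seqE bigmin_le_id.
  by apply/allP => l' l's; apply/implyP => /eqP <-; exact: le_lit.
have Kkappa i : K (kappa i) by rewrite /kappa -kappaE; have [] := uP i.
exists g.
  apply: lterm_bigmin => // l.
  by have [Pl|_] := boolP (P l.2); [exact: lterm_lit|exact: lterm_cst].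
split=> //; exists unit, (fun=> u); split=> // w Aw; exists tt.
rewrite /clause /g le_bigmin_seqE bigmin_le_id /=; apply/allP => l ls /=.
apply: (bigmin_inf_seq c l) => //; rewrite /splice; case: ifP => // _.
by apply: (bigmin_inf_seq c l).
Qed.

Lemma max_fiber_max A P f g f' g' : fiber_max A P f g -> fiber_max A P f' g' ->
  fiber_max A P (fun w => Num.max (f w) (f' w)) (fun w => Num.max (g w) (g' w)).
Proof.
move=> [le_fg [T [u [Au gE]]]] [le_fg' [T' [u' [Au' gE']]]].
split=> [w Aw|]; first by rewrite ge_max !le_max le_fg// le_fg'// orbT.
exists (T + T')%type, (fun x => match x with inl y => u y | inr y => u' y end).
split=> [[y|y] //|w Aw]; have [[y gy] [y' gy']] := (gE w Aw, gE' w Aw).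
have [g'g|gg'] := leP (g' w) (g w).
  by exists (inl y); rewrite le_max gy.
by exists (inr y'); rewrite le_max gy' orbT.
Qed.

Lemma lterm_fiber_max A K G P P' f (top : R) :
  K top -> (forall j x, A x -> G j x <= top) ->
  (forall js, meet_attained A K G js) -> lterm K G P' f ->
  exists2 g, lterm K G P g & fiber_max A P f g.
Proof.
move=> Ktop Gtop att /(lterm_dnf Ktop Gtop).
elim=> {}f => [c s Kc fE|f1 f2 _ [g1 Kg1 f1g1] _ [g2 Kg2 f2g2] fE].
  have [g Kg fg] := clause_fiber_max P s att Kc; exists g => //.
  exact: eq_fiber_max fE fg.
exists (fun w => Num.max (g1 w) (g2 w)); first exact: lterm_max.
exact: eq_fiber_max fE (max_fiber_max f1g1 f2g2).
Qed.

End lattice_terms.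

(** * Quantifier elimination *)

Section sup_finite.
Context {R : realType} {T : finType}.
Implicit Type h : T -> R.

Lemma sup_range_fin (x0 : T) h :
  exists a, sup (range h) = h a /\ forall b, h b <= h a.
Proof.
have [a _ ha] := @arg_maxP _ _ _ x0 xpredT h isT.
exists a; split=> [|b]; last exact: ha.
apply/le_anti/andP; split.
  by apply: ge_sup => [|_ [b _ <-]]; [exists (h a), a|exact: ha].
by apply: ub_le_sup; [exists (h a) => _ [b _ <-]; exact: ha|exists a].
Qed.

Lemma has_ubound_image_fin (B : set T) h : has_ubound (h @` B).
Proof.
exists (\big[Num.max/0]_x h x) => _ [x _ <-]; exact: le_bigmax.
Qed.

End sup_finite.

Lemma inf_imageE {R : realType} {T : Type} (h : T -> R) (B : set T) :
  inf (h @` B) = - sup ((fun x => - h x) @` B).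
Proof. by rewrite /inf image_comp. Qed.

Record structure (R : realType) (Rel : finType) (ar : Rel -> nat) :=
  Structure { dom : nat; interp : interpretation R ar 'I_dom.+1 }.
Arguments interp {R Rel ar} M r _ : rename.

Section structures.
Context {R : realType} {Rel : finType} {ar : Rel -> nat}.
Local Notation I := {r : Rel & (ar r).-tuple nat}.
Local Notation structure := (structure R ar).
Implicit Types (A K : set R) (M : structure) (i : I) (u : I -> R) (k : nat).

Definition structure_valued A M := forall r xs, A (interp M r xs).

Definition level k i : bool := all (fun y => (y < k)%N) (tagged i).

Definition diagram M (e : seq 'I_(dom M).+1) i : R :=
  interp M (tag i) (map_tuple (nth ord0 e) (tagged i)).

(* The new point [b] has position [k] in [rcons e b], so that the atoms whose
   values [u] prescribes are those of level [k.+1] in which [k] occurs. *)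
Definition extension_axiom k u (d : R) M :=
  forall e : k.-tuple 'I_(dom M).+1, uniq e -> exists2 b, b \notin e &
    forall i, level k.+1 i -> ~~ level k i ->
      `|diagram (rcons e b) i - u i| < d.

Definition satisfies_extensions A (F : set_system structure) :=
  forall k u (d : R), valued A u -> 0 < d ->
    \forall M \near F, extension_axiom k u d M.

Lemma diagram_valued A M (e : seq 'I_(dom M).+1) :
  structure_valued A M -> valued A (diagram e).
Proof. by move=> AM i; exact: AM. Qed.

Lemma diagram_rcons k M (e : k.-tuple 'I_(dom M).+1) b :
  {in level k, diagram (rcons e b) =1 diagram e}.
Proof.
move=> i /allP li; rewrite /diagram; congr (interp M _ _).
apply: eq_from_tnth => j.
by rewrite !tnth_map nth_rcons size_tuple li// mem_tnth.
Qed.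

Lemma eq_update_in (D : Type) (s : seq nat) x (v v' : nat -> D) a :
  {in [seq y <- s | y != x], v =1 v'} ->
  {in s, update v x a =1 update v' x a}.
Proof.
move=> vv' y ys; rewrite /update; case: eqVneq => // yx.
by rewrite vv'// mem_filter yx.
Qed.

Lemma value_eq_free_vars (neg : R -> R) M (phi : formula ar) v v' :
  {in free_vars phi, v =1 v'} ->
  value neg (interp M) v phi = value neg (interp M) v' phi.
Proof.
elim: phi v v' =>
  [r xs|f IHf g IHg|f IHf g IHg|f IHf|x f IHf|x f IHf] v v' /= vv'.
- congr (interp M _ _); apply: eq_from_tnth => j.
  by rewrite !tnth_map vv'// mem_tnth.
- by rewrite (IHf v v') ?(IHg v v')// => y yf; apply: vv';
    rewrite mem_cat yf ?orbT.
- by rewrite (IHf v v') ?(IHg v v')// => y yf; apply: vv';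
    rewrite mem_cat yf ?orbT.
- by rewrite (IHf v v').
- by under eq_fun => a do rewrite (IHf _ _ (eq_update_in a vv')).
- by under eq_fun => a do rewrite (IHf _ _ (eq_update_in a vv')).
Qed.

Lemma extension_splice A (f : (I -> R) -> R) k u (d eps : R) M
    (e : k.-tuple 'I_(dom M).+1) :
  (forall w w', valued A w -> valued A w' ->
     {in level k.+1, forall i, `|w i - w' i| < d} -> `|f w - f w'| < eps) ->
  structure_valued A M -> valued A u -> 0 < d -> extension_axiom k u d M ->
  uniq e -> exists2 b, b \notin e & `|f (diagram (rcons e b)) -
                            f (splice (level k) (diagram e) u)| < eps.
Proof.
move=> f_unif AM Au d0 extM ue; have [b be bP] := extM e ue; exists b => //.
apply: f_unif => [||i li]; first exact: diagram_valued.
  by apply: splice_valued => //; exact: diagram_valued.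
rewrite /splice; case: ifPn => [lki|]; last exact: bP.
by rewrite diagram_rcons// subrr normr0.
Qed.

Lemma value_valued A (neg : R -> R) M v (phi : formula ar) :
  (forall x, A x -> A (neg x)) -> structure_valued A M ->
  A (value neg (interp M) v phi).
Proof.
move=> Aneg AM.
elim: phi v => [r xs|f IHf g IHg|f IHf g IHg|f IHf|x f IHf|x f IHf] v /=.
- exact: AM.
- by case: leP.
- by case: leP.
- exact: Aneg.
- rewrite inf_imageE.
  have [a [-> _]] :=
    sup_range_fin ord0 (fun a => - value neg (interp M) (update v x a) f).
  by rewrite opprK.
- have [a [-> _]] :=
    sup_range_fin ord0 (fun a => value neg (interp M) (update v x a) f).
  exact: IHf.
Qed.

End structures.

Section quantifier_elimination.
Context {R : realType} {Rel : finType} {ar : Rel -> nat}.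
Local Notation I := {r : Rel & (ar r).-tuple nat}.
Local Notation structure := (structure R ar).
Context (A : set R) (F : set_system structure) {FF : Filter F}.
Context (near_valued : \forall M \near F, structure_valued A M).
Context (near_extension : satisfies_extensions A F).
Implicit Types (K : set R) (G : nat -> R -> R) (fv : seq nat).
Implicit Types (h : forall M : structure, (nat -> 'I_(dom M).+1) -> R).

Local Notation predicate k :=
  (forall M : structure, k.-tuple 'I_(dom M).+1 -> R).

Definition approximates k (H : predicate k) (f : (I -> R) -> R) :=
  forall eps : R, 0 < eps -> \forall M \near F,
    forall e : k.-tuple 'I_(dom M).+1, uniq e ->
      `|H M e - f (diagram e)| <= eps.

Definition approximable K G k (H : predicate k) :=
  exists2 f, lterm K G (level k) f & approximates H f.

Section approximable.
Context {K : set R} {G : nat -> R -> R} {k : nat}.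
Implicit Types H : predicate k.

Lemma near_eq_approximable H H' :
  (\forall M \near F, forall e : k.-tuple _, uniq e -> H M e = H' M e) ->
  approximable K G H' -> approximable K G H.
Proof.
move=> HH' [f Kf H'f]; exists f => // eps eps0.
near=> M => e ue; rewrite (near HH' M)//.
by move: e ue; near: M; exact: H'f.
Unshelve. all: by end_near. Qed.

Lemma approximable_opp H : approximable K G H ->
  approximable (-%R @` K) (fun j x => - G j x) (fun M e => - H M e).
Proof.
move=> [f Kf Hf]; exists (fun w => - f w); first exact: lterm_opp.
move=> eps /Hf; apply: filterS => M HfM e ue.
by rewrite -opprD normrN; exact: HfM.
Qed.

Lemma approximable_min H H' : approximable K G H -> approximable K G H' ->
  approximable K G (fun M e => Num.min (H M e) (H' M e)).
Proof.
move=> [f Kf Hf] [f' Kf' Hf']; exists (fun w => Num.min (f w) (f' w)).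
  exact: lterm_min.
move=> eps eps0; apply: filterS2 (Hf _ eps0) (Hf' _ eps0) => M HfM Hf'M e ue.
by rewrite (le_trans (dist_min_le _ _ _ _))// ge_max HfM// Hf'M.
Qed.

Lemma approximable_max H H' : approximable K G H -> approximable K G H' ->
  approximable K G (fun M e => Num.max (H M e) (H' M e)).
Proof.
move=> [f Kf Hf] [f' Kf' Hf']; exists (fun w => Num.max (f w) (f' w)).
  exact: lterm_max.
move=> eps eps0; apply: filterS2 (Hf _ eps0) (Hf' _ eps0) => M HfM Hf'M e ue.
by rewrite (le_trans (dist_max_le _ _ _ _))// ge_max HfM// Hf'M.
Qed.

Lemma approximable_bigmax (T : Type) (s : seq T) (Hs : T -> predicate k) H :
  approximable K G H -> (forall x, approximable K G (Hs x)) ->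
  approximable K G (fun M e => \big[Num.max/H M e]_(x <- s) Hs x M e).
Proof.
move=> KH KHs; elim: s => [|x s IH].
  by apply: near_eq_approximable KH; apply: nearW => M e _; rewrite big_nil.
apply: near_eq_approximable (approximable_max (KHs x) IH).
by apply: nearW => M e _; rewrite big_cons.
Qed.

End approximable.

Lemma approximable_oppK K G k (H : predicate k) :
  approximable (-%R @` K) (fun j x => - G j x) (fun M e => - H M e) ->
  approximable K G H.
Proof.
move=> /approximable_opp; rewrite image_comp.
rewrite (_ : -%R \o -%R = id) ?image_id; last first.
  by apply/funext => x /=; rewrite opprK.
rewrite (_ : (fun _ _ => _) = G) => [[f Kf Hf]|].
  exists f => // eps /Hf; apply: filterS => M HfM e ue.
  by rewrite -[H M e]opprK HfM.
by apply/funext => j; apply/funext => x; rewrite opprK.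
Qed.

(* [h] is a function of the points assigned to the variables in [fv]; for every
   pattern [v] of equalities between them it is approximated by a lattice term
   in the atoms of the distinct points. *)
Definition eliminable K G fv h := forall k (v : nat -> nat),
  {in fv, forall y, v y < k}%N ->
  approximable K G
    (fun M (e : k.-tuple 'I_(dom M).+1) => h M (nth ord0 e \o v)).

Lemma eliminable_min K G fv fv' h h' :
  eliminable K G fv h -> eliminable K G fv' h' ->
  eliminable K G (fv ++ fv') (fun M a => Num.min (h M a) (h' M a)).
Proof.
move=> elim_h elim_h' k v vk.
by apply: approximable_min; [apply: elim_h|apply: elim_h'] => y yfv;
  apply: vk; rewrite mem_cat yfv ?orbT.
Qed.

Lemma eliminable_max K G fv fv' h h' :
  eliminable K G fv h -> eliminable K G fv' h' ->
  eliminable K G (fv ++ fv') (fun M a => Num.max (h M a) (h' M a)).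
Proof.
move=> elim_h elim_h' k v vk.
by apply: approximable_max; [apply: elim_h|apply: elim_h'] => y yfv;
  apply: vk; rewrite mem_cat yfv ?orbT.
Qed.

Section supremum.
Context (K : set R) (G : nat -> R -> R) (top : R).
Context (A_neq0 : A !=set0) (K_top : K top).
Context (G_top : forall j x, A x -> G j x <= top).
Context (G_attained : forall js, meet_attained A K G js).
Context (G_unif : forall j, unif_continuous_on A (G j)).

Lemma approximable_sup_new k (H : predicate k.+1) : approximable K G H ->
  approximable K G (fun M (e : k.-tuple 'I_(dom M).+1) =>
    sup [set H M [tuple of rcons e b] | b in [set b | b \notin e]]).
Proof.
move=> [f Kf Hf].
have [g Kg [le_fg [T [u [Au gE]]]]] :=
  lterm_fiber_max (level k) K_top G_top G_attained Kf.
exists g => // eps eps0; have eps20 : 0 < eps / 2 by rewrite divr_gt0.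
have [d d0 f_unif] := lterm_unif_continuous G_unif Kf eps20.
have near_ext : \forall M \near F, forall x, extension_axiom k (u x) d M.
  by apply: filter_forall => x; exact: near_extension.
near=> M => e ue.
have AM : structure_valued A M by near: M.
have HM : forall e' : k.+1.-tuple 'I_(dom M).+1, uniq e' ->
    `|H M e' - f (diagram e')| <= eps / 2 by near: M; exact: Hf.
have HMe b : b \notin e ->
    `|H M [tuple of rcons e b] - f (diagram (rcons e b))| <= eps / 2.
  by move=> be; apply: HM; rewrite rcons_uniq be.
have extM : forall x, extension_axiom k (u x) d M by near: M.
have [x gx] := gE _ (diagram_valued e AM).
have [c ce fc] := extension_splice f_unif AM (Au x) d0 (extM x) ue.
rewrite ler_distl; apply/andP; split.
  apply: le_trans (_ : H M [tuple of rcons e c] <= _); last first.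
    by apply: ub_le_sup; [exact: has_ubound_image_fin|exists c].
  by have := HMe _ ce; move: fc; rewrite ltr_distl ler_distl; lra.
apply: ge_sup => [|_ [b be <-]]; first by exists (H M [tuple of rcons e c]), c.
have : f (diagram (rcons e b)) <= g (diagram e).
  rewrite -(lterm_eq_in Kg (@diagram_rcons _ _ _ _ _ e b)).
  by apply: le_fg; exact: diagram_valued.
by have := HMe _ be; rewrite ler_distl; lra.
Unshelve. all: by end_near. Qed.

Lemma sup_update_split fv h k x v M (e : k.-tuple 'I_(dom M).+1) :
  {in fv, forall y, y != x -> v y < k}%N ->
  (forall a a', {in fv, a =1 a'} -> h M a = h M a') ->
  uniq e -> (exists b, b \notin e) ->
  sup (range (fun b => h M (update (nth ord0 e \o v) x b))) =
  \big[Num.max/sup [set h M (nth ord0 (rcons e b) \o update v x k) |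
                      b in [set b | b \notin e]]]_(j < k)
    h M (nth ord0 e \o update v x j).
Proof.
move=> vk h_fv ue [c ce].
have old (j : 'I_k) : h M (nth ord0 e \o update v x j) =
    h M (update (nth ord0 e \o v) x (nth ord0 e j)).
  by congr (h M); apply/funext => y; rewrite /= /update; case: eqP.
have new b : h M (nth ord0 (rcons e b) \o update v x k) =
    h M (update (nth ord0 e \o v) x b).
  apply: h_fv => y yfv; rewrite /update /=; case: eqVneq => [_|yx].
    by rewrite nth_rcons size_tuple ltnn eqxx.
  by rewrite nth_rcons size_tuple vk.
have S_ub : has_ubound (range (fun b => h M (update (nth ord0 e \o v) x b))).
  exact: has_ubound_image_fin.
apply/le_anti/andP; split.
  apply: ge_sup => [|_ [b _ <-]].
    by exists (h M (update (nth ord0 e \o v) x c)), c.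
  have [be|be] := boolP (b \in e).
    have bk : (index b e < k)%N by rewrite -{2}(size_tuple e) index_mem.
    apply: (bigmax_sup (Ordinal bk)) => //.
    by rewrite old /= nth_index.
  apply: (le_trans _ (bigmax_ge_id _ _ _ _)); rewrite -new; apply: ub_le_sup.
    exact: has_ubound_image_fin.
  by exists b.
apply: bigmax_le => [|j _]; last first.
  by rewrite old; apply: ub_le_sup => //; exists (nth ord0 e j).
apply: ge_sup => [|_ [b _ <-]].
  by exists (h M (nth ord0 (rcons e c) \o update v x k)), c.
by rewrite new; apply: ub_le_sup => //; exists b.
Qed.

Lemma eliminable_sup fv h x :
  (forall M a a', {in fv, a =1 a'} -> h M a = h M a') -> eliminable K G fv h ->
  eliminable K G [seq y <- fv | y != x]
    (fun M a => sup (range (fun b => h M (update a x b)))).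
Proof.
move=> h_fv elim_h k v vk.
have vk' : {in fv, forall y, y != x -> v y < k}%N.
  by move=> y yfv yx; rewrite vk// mem_filter yx.
have upd_lt m j : (j < m)%N -> (k <= m)%N ->
    {in fv, forall y, update v x j y < m}%N.
  move=> jm km y yfv; rewrite /update; case: eqVneq => // yx.
  by rewrite (leq_trans (vk' _ _ _)).
have old (j : 'I_k) := elim_h k _ (upd_lt k j (ltn_ord j) (leqnn k)).
have new := approximable_sup_new
  (elim_h k.+1 _ (upd_lt k.+1 k (leqnn _) (leqnSn k))).
apply: near_eq_approximable (approximable_bigmax (index_enum 'I_k) new old).
have [u0 Au0] := A_neq0.
have := near_extension k (fun=> Au0) ltr01; apply: filterS => M extM e ue.
by apply: (sup_update_split vk' (h_fv M) ue); have [b] := extM _ ue; exists b.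
Qed.

End supremum.

Section value.
Context (K : set R) (neg : R -> R) (bot top : R).
Context (A_bounded : forall x, A x -> bot <= x <= top).
Context (KA : K `<=` A) (K_bot : K bot) (K_top : K top).
Context (A_neg : forall x, A x -> A (neg x)).
Context (K_neg : forall x, K x -> K (neg x)).
Context (neg_unif : unif_continuous_on A neg).
Context (neg_min : forall x y, A x -> A y ->
  neg (Num.min x y) = Num.max (neg x) (neg y)).
Context (neg_max : forall x y, A x -> A y ->
  neg (Num.max x y) = Num.min (neg x) (neg y)).
Local Notation G := (fun j x => iter j neg x).
Context (sup_attained : forall js, meet_attained A K G js).
Context (inf_attained : forall js,
  meet_attained A (-%R @` K) (fun j x => - G j x) js).

Lemma iter_neg_in j x : A x -> A (iter j neg x).
Proof. by move=> Ax; elim: j => //= j; exact: A_neg. Qed.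

Lemma iter_neg_unif_continuous j : unif_continuous_on A (iter j neg).
Proof.
elim: j => [|j IH]; first exact: unif_continuous_on_id.
by apply: (unif_continuous_on_comp (B := A)) IH => // x; exact: iter_neg_in.
Qed.

Lemma approximable_neg k (H : predicate k) :
  (forall M e, structure_valued A M -> A (H M e)) ->
  approximable K G H -> approximable K G (fun M e => neg (H M e)).
Proof.
move=> AH [f Kf Hf].
have negG j x : neg (iter j neg x) = iter j.+1 neg x by [].
have [g Kg gE] := lterm_neg KA K_neg iter_neg_in negG neg_min neg_max Kf.
exists g => // eps /neg_unif[d d0 dP].
have d20 : 0 < d / 2 by rewrite divr_gt0.
apply: filterS2 near_valued (Hf _ d20) => M AM HfM e ue.
have Ae := diagram_valued e AM; rewrite gE//; apply/ltW/dP; first exact: AH.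
  by apply: lterm_valued Kf Ae => //; exact: iter_neg_in.
by rewrite (le_lt_trans (HfM e ue))//; lra.
Qed.

Lemma eliminable_atom r (xs : (ar r).-tuple nat) :
  eliminable K G xs (fun M a => interp M r (map_tuple a xs)).
Proof.
move=> k v vk; pose i : I := existT _ r (map_tuple v xs).
exists (fun w => iter 0 neg (w i)).
  apply: (lterm_lit _ (fun j x => iter j neg x)).
  by apply/allP => _ /mapP[y yxs ->]; exact: vk.
move=> eps eps0; apply: nearW => M e _; rewrite /diagram /=.
rewrite (_ : map_tuple _ (map_tuple v xs) = map_tuple (nth ord0 e \o v) xs).
  by rewrite subrr normr0 ltW.
by apply: eq_from_tnth => j; rewrite !tnth_map.
Qed.

Lemma eliminable_inf fv h x :
  (forall M a a', {in fv, a =1 a'} -> h M a = h M a') -> eliminable K G fv h ->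
  eliminable K G [seq y <- fv | y != x]
    (fun M a => inf (range (fun b => h M (update a x b)))).
Proof.
move=> h_fv elim_h k v vk; apply: approximable_oppK.
have NG_le j y : A y -> - iter j neg y <= - bot.
  by move=> /(iter_neg_in j)/A_bounded/andP[]; rewrite lerN2.
have elim_Nh :
    eliminable (-%R @` K) (fun j x => - G j x) fv (fun M a => - h M a).
  by move=> k' v' /elim_h; exact: approximable_opp.
have Nh_fv M a a' : {in fv, a =1 a'} -> - h M a = - h M a' by move=> /h_fv ->.
apply: near_eq_approximable
  (eliminable_sup _ _ NG_le inf_attained _ Nh_fv elim_Nh vk).
- by apply: nearW => M e _; rewrite inf_imageE opprK.
- by exists bot; exact: KA.
- by exists bot.
- by move=> j; apply: unif_continuous_onN; exact: iter_neg_unif_continuous.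
Qed.

Lemma eliminable_value (phi : formula ar) :
  eliminable K G (free_vars phi) (fun M a => value neg (interp M) a phi).
Proof.
elim: phi => [r xs|f IHf g IHg|f IHf g IHg|f IHf|x f IHf|x f IHf] /=.
- exact: eliminable_atom.
- exact: eliminable_min.
- exact: eliminable_max.
- move=> k v vk; apply: approximable_neg (IHf k v vk) => M e AM.
  exact: value_valued.
- by apply: eliminable_inf IHf => M a a'; exact: value_eq_free_vars.
- apply: (eliminable_sup _ K_top _ sup_attained) IHf => [|j y|j|M a a'].
  + by exists bot; exact: KA.
  + by move=> /(iter_neg_in j)/A_bounded/andP[].
  + exact: iter_neg_unif_continuous.
  + exact: value_eq_free_vars.
Qed.

Lemma value_sentence_cvg (phi : formula ar) : (forall r, (0 < ar r)%N) ->
  sentence phi ->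
  exists2 c, K c & value neg (interp M) (fun=> ord0) phi @[M --> F] --> c.
Proof.
move=> ar_gt0 phi_closed.
have [y|f Kf phif] := @eliminable_value phi 0%N (fun=> 0%N).
  by rewrite (phi_closed : free_vars phi = [::]).
have level0 : level 0 =1 (pred0 : pred I).
  move=> [r xs]; rewrite /level /=; case: xs => -[|x xs] //= /eqP sz.
  by have := ar_gt0 r; rewrite -sz.
have [c Kc fE] := lterm_pred0 level0 Kf; exists c => //.
apply/cvgrPdist_le => eps /phif; apply: filterS => M /(_ [tuple] isT).
by rewrite fE distrC.
Qed.

End value.

End quantifier_elimination.

(** * Independence in finite products *)

Section real_probability.
Context d (T : measurableType d) (R : realType) (P : probability T R).

Definition pr (X : set T) : R := fine (P X).

Lemma prE X : measurable X -> P X = (pr X)%:E.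
Proof. by move=> mX; rewrite /pr fineK// fin_num_measure. Qed.

Lemma pr_ge0 X : 0 <= pr X.
Proof. by rewrite fine_ge0. Qed.

Lemma pr_le1 X : measurable X -> pr X <= 1.
Proof. by move=> mX; rewrite -lee_fin -prE// probability_le1. Qed.

Lemma pr0 : pr set0 = 0.
Proof. by rewrite /pr measure0. Qed.

Lemma prT : pr setT = 1.
Proof. by rewrite /pr probability_setT. Qed.

Lemma le_pr X Y : measurable X -> measurable Y -> X `<=` Y -> pr X <= pr Y.
Proof.
by move=> mX mY XY; rewrite -lee_fin -!prE//; apply: le_measure; rewrite ?inE.
Qed.

Lemma prD X Y : measurable X -> measurable Y ->
  pr (X `\` Y) = pr X - pr (X `&` Y).
Proof.
move=> mX mY; apply: EFin_inj; rewrite EFinB -!prE.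
- by rewrite measureD//; exact: le_lt_trans (probability_le1 P mX) (ltry _).
- exact: measurableI.
- by [].
- exact: measurableD.
Qed.

Lemma prC X : measurable X -> pr (~` X) = 1 - pr X.
Proof. by move=> mX; rewrite -setTD prD// setTI prT. Qed.

Lemma prU_le X Y : measurable X -> measurable Y -> pr (X `|` Y) <= pr X + pr Y.
Proof.
move=> mX mY; rewrite -lee_fin EFinD -!prE//; first exact: measureU2.
exact: measurableU.
Qed.

Lemma pr_bigsetU_le J (s : seq J) (Q : pred J) (F : J -> set T) :
  (forall j, measurable (F j)) ->
  pr (\big[setU/set0]_(j <- s | Q j) F j) <= \sum_(j <- s | Q j) pr (F j).
Proof.
move=> mF; elim: s => [|j s IH]; first by rewrite !big_nil pr0.
rewrite !big_cons; case: ifP => // _; rewrite (le_trans (prU_le _ _))//.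
  exact: bigsetU_measurable.
by rewrite lerD2l.
Qed.

End real_probability.

Section product_independence.
Context d (T : measurableType d) (R : realType) (N : nat).
Context (P : 'I_N -> probability T R).
Local Notation Pr := (pr (product_probability P)).
Implicit Types B C : 'I_N -> set T.

Definition rect B := [set t : N.-tuple T | forall i, B i (tnth t i)].

Lemma measurable_rect B : (forall i, measurable (B i)) -> measurable (rect B).
Proof.
move=> mB; rewrite (_ : rect B = \bigcap_i ((fun t => tnth t i) @^-1` B i)).
  apply: fin_bigcap_measurable => // i _.
  by rewrite -[X in measurable X]setTI; exact: measurable_tnth.
by apply/seteqP; split=> [t tB i _|t tB i]; exact: tB.
Qed.

Lemma rectT : rect (fun=> setT) = setT.
Proof. by apply/seteqP; split. Qed.

Lemma rectI B C : rect B `&` rect C = rect (fun i => B i `&` C i).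
Proof.
apply/seteqP; split=> t /=; first by move=> [tB tC] i.
by move=> tBC; split=> i; have [] := tBC i.
Qed.

Lemma pr_rect B : (forall i, measurable (B i)) ->
  Pr (rect B) = \prod_i pr (P i) (B i).
Proof.
move=> mB; rewrite /pr /rect product_probability_rect//.
rewrite (eq_bigr (fun i => (pr (P i) (B i))%:E)) ?prodEFin// => i _.
exact: prE.
Qed.

Definition disjoint_support B C := forall i, B i = setT \/ C i = setT.

Lemma pr_rectI B C : (forall i, measurable (B i)) ->
  (forall i, measurable (C i)) -> disjoint_support B C ->
  Pr (rect B `&` rect C) = Pr (rect B) * Pr (rect C).
Proof.
move=> mB mC BC; rewrite rectI !pr_rect//; last by move=> i; exact: measurableI.
rewrite -big_split; apply: eq_bigr => i _ /=.
by have [->|->] := BC i; rewrite ?setTI ?setIT prT ?mul1r ?mulr1.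
Qed.

Lemma measurable_bigsetI_setC_rect (J : Type) (B : J -> 'I_N -> set T)
    (s : seq J) :
  (forall b i, measurable (B b i)) ->
  measurable (\big[setI/setT]_(b <- s) ~` rect (B b)).
Proof.
move=> mB; apply: bigsetI_measurable => b _.
by apply: measurableC; exact: measurable_rect.
Qed.

Lemma pr_rectI_setC (J : eqType) (B : J -> 'I_N -> set T) (s : seq J) C :
  (forall b i, measurable (B b i)) -> (forall i, measurable (C i)) -> uniq s ->
  {in s &, forall b b', b != b' -> disjoint_support (B b) (B b')} ->
  {in s, forall b, disjoint_support C (B b)} ->
  Pr (rect C `&` \big[setI/setT]_(b <- s) ~` rect (B b)) =
    Pr (rect C) * \prod_(b <- s) (1 - Pr (rect (B b))).
Proof.
move=> mB; elim: s C => [|b s IH] C mC; first by rewrite !big_nil setIT mulr1.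
rewrite !big_cons => /andP[bs us] disjB disjC.
have in_bs c : c \in s -> c \in b :: s by rewrite inE orbC => ->.
have disjBs : {in s &, forall c c', c != c' -> disjoint_support (B c) (B c')}.
  by move=> c c' /in_bs cs /in_bs c's; exact: disjB.
have disjCB : {in s, forall c, disjoint_support (fun i => C i `&` B b i) (B c)}.
  move=> c cs i; have bc : b != c by apply: contraNneq bs => ->.
  have [->|->] := disjC c (in_bs _ cs) i; last by right.
  have [->|->] := disjB b c (mem_head _ _) (in_bs _ cs) bc i; last by right.
  by left; rewrite setTI.
have disjCs : {in s, forall c, disjoint_support C (B c)}.
  by move=> c /in_bs; exact: disjC.
have mCB i : measurable (C i `&` B b i) by exact: measurableI.
have mCs : measurable (rect C `&` \big[setI/setT]_(c <- s) ~` rect (B c)).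
  apply: measurableI; first exact: measurable_rect.
  exact: measurable_bigsetI_setC_rect.
rewrite setICA setIC -setDE prD//; last exact: measurable_rect.
rewrite setIAC rectI (IH C)// (IH _ mCB)// -rectI pr_rectI//.
  by ring.
by apply: disjC; exact: mem_head.
Qed.

Lemma pr_setC_rect_le (J : eqType) (B : J -> 'I_N -> set T) (s : seq J)
    (q : R) :
  (forall b i, measurable (B b i)) -> uniq s ->
  {in s &, forall b b', b != b' -> disjoint_support (B b) (B b')} ->
  {in s, forall b, q <= Pr (rect (B b))} ->
  Pr (\big[setI/setT]_(b <- s) ~` rect (B b)) <= (1 - q) ^+ size s.
Proof.
move=> mB us disjB qB.
have := @pr_rectI_setC _ B s (fun=> setT) mB (fun=> measurableT) us disjB.
rewrite rectT setTI prT mul1r => ->; last by move=> b _ i; left.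
elim: s {us disjB} qB => [|b s IH] qB; first by rewrite big_nil.
rewrite big_cons exprS ler_pM//.
- by rewrite subr_ge0 pr_le1//; exact: measurable_rect.
- by apply: prodr_ge0 => c _; rewrite subr_ge0 pr_le1//; exact: measurable_rect.
- by rewrite lerB// qB// mem_head.
- by apply: IH => c cs; apply: qB; rewrite inE cs orbT.
Qed.

End product_independence.

Section polynomial_times_geometric.
Context {R : realType}.
Implicit Types (x : R) (k : nat).

(* For [q := 1 - |x|], [|x| ^ n <= exp (- q n)], which decays faster than any
   power of [n]. *)
Lemma cvg_polyM_geometric x k : `|x| < 1 ->
  n%:R ^+ k * x ^+ n @[n --> \oo] --> (0 : R).
Proof.
move=> x1; pose q := 1 - `|x|; pose C := k.+1`!%:R / q ^+ k.+1.
have q0 : 0 < q by rewrite subr_gt0.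
rewrite -cvg_shiftS; apply/norm_cvg0P.
apply: (@squeeze_cvgr _ _ _ _ (fun=> 0) (fun n => C * harmonic n));
  last 2 first.
- exact: cvg_cst.
- by rewrite -(mulr0 C); apply: cvgMr; exact: cvg_harmonic.
apply: nearW => n /=; rewrite normr_ge0 normrM !normrX normr_nat /=.
have n0 : 0 < n.+1%:R :> R by [].
have xn : `|x| ^+ n.+1 <= (expR (q * n.+1%:R))^-1.
  rewrite -expRN -mulNr expRM_natr lerXn2r ?nnegrE ?expR_ge0//.
  by rewrite (le_trans _ (expR_ge1Dx _))// /q opprB addrCA subrr addr0.
have expn : (q * n.+1%:R) ^+ k.+1 / k.+1`!%:R <= expR (q * n.+1%:R).
  have qn0 : 0 <= q * n.+1%:R by rewrite mulr_ge0// ltW.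
  by apply: le_trans (expR_ge1Dxn k qn0); rewrite lerDr.
apply: (le_trans (ler_wpM2l _ xn)); first by rewrite exprn_ge0.
rewrite ler_pdivrMr ?expR_gt0//; apply: le_trans (ler_wpM2l _ expn); last first.
  by rewrite mulr_ge0 ?invr_ge0// divr_ge0// exprn_ge0// ltW.
suff -> : n.+1%:R ^+ k =
  C / n.+1%:R * ((q * n.+1%:R) ^+ k.+1 / k.+1`!%:R) by [].
rewrite /C exprMn [n.+1%:R ^+ k.+1]exprS; field.
by rewrite !gt_eqF ?exprn_gt0// ltr0n fact_gt0.
Qed.

Lemma cvg_polyM_geometric_shift x k : `|x| < 1 ->
  n%:R ^+ k * x ^+ (n - k) @[n --> \oo] --> (0 : R).
Proof.
move=> x1; rewrite -(cvg_shiftn k); apply/norm_cvg0P.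
apply: (@squeeze_cvgr _ _ _ _ (fun=> 0)
    (fun n => k.+1%:R ^+ k * `|n%:R ^+ k * x ^+ n|)); last 2 first.
- exact: cvg_cst.
- rewrite -(mulr0 (k.+1%:R ^+ k)); apply: cvgMr.
  by apply/norm_cvg0P; exact: cvg_polyM_geometric.
near=> n; rewrite normr_ge0 /= addnK !normrM mulrA ler_wpM2r//.
rewrite !normrX !normr_nat -exprMn lerXn2r ?nnegrE// -natrM ler_nat.
by rewrite mulSn leq_add2l leq_pmulr//; near: n; exact: nbhs_infty_gt.
Unshelve. all: by end_near. Qed.

End polynomial_times_geometric.

(** * Random structures *)

Lemma measurable_ball (R : realType) (x d : R) : measurable (ball x d).
Proof. by apply: open_measurable; exact: ball_open. Qed.

Section measurable_finite_extrema.
Context {d} {T : measurableType d} {R : realType} {J : finType} (j0 : J).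
Implicit Type h : J -> T -> R.

Lemma measurable_sup_range h :
  (forall j, measurable_fun setT (h j)) ->
  measurable_fun setT (fun t => sup (range (h ^~ t))).
Proof.
move=> mh; rewrite (_ : (fun t => _) = (fun t => \big[Num.max/h j0 t]_j h j t)).
  elim: (index_enum _) => [|j s IH].
    by under eq_fun do rewrite big_nil; exact: mh.
  by under eq_fun do rewrite big_cons; exact: measurable_maxr.
apply/funext => t; have [j [-> jmax]] := sup_range_fin j0 (h ^~ t).
apply/le_anti; rewrite (bigmax_sup j)//=.
by apply: bigmax_le => [|j' _]; exact: jmax.
Qed.

Lemma measurable_inf_range h :
  (forall j, measurable_fun setT (h j)) ->
  measurable_fun setT (fun t => inf (range (h ^~ t))).
Proof.
move=> mh; under eq_fun do rewrite inf_imageE; apply: measurableT_comp => //.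
apply: (measurable_sup_range (h := fun j t => - h j t)) => j.
exact: measurableT_comp.
Qed.

End measurable_finite_extrema.

Section almost_all.
Context {R : realType} {Rel : finType} {ar : Rel -> nat}.
Context (p : Rel -> probability R R).
Local Notation structure := (structure R ar).
Local Notation points n := (#|atom_index ar n.+1|.-tuple R).
Local Notation Pr n := (pr (rho ar p n.+1)).

Definition structure_of n (w : points n) : structure := Structure (interp_of w).

Definition almost_all : set_system structure :=
  [set S | exists E : forall n, set (points n),
    [/\ forall n, measurable (E n),
        forall n w, ~ E n w -> S (structure_of w) &
        Pr n (E n) @[n --> \oo] --> (0 : R)]].

Global Instance almost_all_filter : ProperFilter almost_all.
Proof.
apply: Build_ProperFilter.
  move=> [E [mE ET PrE0]].
  have PrE1 : (fun n => Pr n (E n)) = fun=> 1.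
    apply/funext => n; rewrite (_ : E n = setT) ?prT//.
    by apply/seteqP; split=> // w _; apply: contrapT => /ET.
  rewrite PrE1 in PrE0.
  have /eqP := oner_neq0 R; apply; apply/esym.
  exact: (cvg_unique (@Rhausdorff R) PrE0 (cvg_cst (1 : R))).
split=> [|S S' [E [mE ES PrE0]] [E' [mE' ES' PrE'0]]|S S' SS' [E [mE ES PrE0]]].
- exists (fun=> set0); split=> [n|n w //|]; first exact: measurable0.
  by under eq_fun do rewrite pr0; exact: cvg_cst.
- exists (fun n => E n `|` E' n); split=> [n|n w /not_orP[/ES Sw /ES' S'w] //|].
    by apply: measurableU; [exact: mE|exact: mE'].
  apply: (@squeeze_cvgr _ _ _ _ (fun=> 0) (fun n => Pr n (E n) + Pr n (E' n))).
  + by apply: nearW => n; rewrite pr_ge0 prU_le//; [exact: mE|exact: mE'].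
  + exact: cvg_cst.
  + by rewrite -(addr0 0); exact: cvgD.
- by exists E; split=> // n w /ES; exact: SS'.
Qed.

End almost_all.
Arguments almost_all {R Rel} ar p _.

Section extension_axioms.
Context {R : realType} {Rel : finType} {ar : Rel -> nat}.
Context (A : set R) (mA : measurable A) (p : Rel -> probability R R).
Context (p_full : forall r (U : set R), open U -> A `&` U !=set0 ->
    (0 < p r (A `&` U))%E).
Local Notation I := {r : Rel & (ar r).-tuple nat}.
Local Notation points n := (#|atom_index ar n.+1|.-tuple R).
Local Notation Pr n := (pr (rho ar p n.+1)).
Implicit Types (u : I -> R) (d : R).

Definition atom_nat k (j : atom_index ar k) : I :=
  existT _ (tag j) (map_tuple val (tagged j)).

Definition atom_at n (e : seq 'I_n.+1) (i : I) : atom_index ar n.+1 :=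
  existT _ (tag i) (map_tuple (nth ord0 e) (tagged i)).

Lemma atom_at_inj n k (e : k.-tuple 'I_n.+1) : uniq e ->
  injective (fun j : atom_index ar k => atom_at e (atom_nat j)).
Proof.
move=> ue [r xs] [r' xs'] /eqP; rewrite /atom_at /atom_nat /=.
rewrite -tag_eqE /tag_eq /= => /andP[/eqP rr']; subst r'.
rewrite tagged_asE => /eqP xsE; congr existT; apply: eq_from_tnth => l.
apply/val_inj/eqP; have /eqP := congr1 (fun t => tnth t l) xsE.
by rewrite !tnth_map nth_uniq ?size_tuple.
Qed.

(* The coordinates constrained by [ext_box u d e b] are those mentioning [b],
   hence disjoint for distinct [b] outside [e]. *)
Definition ext_box k n u d (e : k.-tuple 'I_n.+1) (b : 'I_n.+1)
    (c : 'I_#|atom_index ar n.+1|) : set R :=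
  \big[setI/setT]_(j : atom_index ar k.+1 |
      (ord_max \in tagged j) &&
      (atom_at (rcons e b) (atom_nat j) == enum_val c))
    ball (u (atom_nat j)) d.

Lemma measurable_ext_box k n u d (e : k.-tuple 'I_n.+1) b c :
  measurable (ext_box u d e b c).
Proof. by apply: bigsetI_measurable => j _; exact: measurable_ball. Qed.

Lemma ext_box_disjoint_support k n u d (e : k.-tuple 'I_n.+1) b b' :
  b \notin e -> b != b' ->
  disjoint_support (ext_box u d e b) (ext_box u d e b').
Proof.
move=> be bb' c; have [bc|bc] := boolP (b \in tagged (enum_val c)).
- right; apply: big_pred0 => j; apply/negP => /andP[_ /eqP cE].
  move: bc; rewrite -cE => /mapP[y /= /mapP[z _ ->]] bE.
  have : b \in rcons e b' by rewrite bE mem_nth// size_rcons size_tuple.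
  by rewrite mem_rcons inE (negbTE bb') (negbTE be).
- left; apply: big_pred0 => j; apply/negP => /andP[jk /eqP cE].
  move: bc; rewrite -cE => /mapP[]; exists k; last first.
    by rewrite nth_rcons size_tuple ltnn eqxx.
  by apply/mapP; exists ord_max.
Qed.

Lemma rect_ext_box k n u d (e : k.-tuple 'I_n.+1) b (w : points n) i :
  rect (ext_box u d e b) w -> level k.+1 i -> ~~ level k i ->
  `|diagram (M := structure_of w) (rcons e b) i - u i| < d.
Proof.
move=> /(_ (enum_rank (atom_at (rcons e b) i))) wi lt_i /allPn[y yi].
rewrite -leqNgt => ky; have yk : y = k.
  by apply/eqP; rewrite eqn_leq ky andbT -ltnS; exact: (allP lt_i).
pose j : atom_index ar k.+1 := existT _ (tag i) (map_tuple inord (tagged i)).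
have jE : atom_nat j = i.
  case: i @j lt_i {wi yi} => r xs j lt_i; congr existT; apply: eq_from_tnth.
  by move=> l; rewrite !tnth_map /= inordK// (allP lt_i)// mem_tnth.
have jk : ord_max \in tagged j.
  by apply/mapP; exists y => //; apply: val_inj; rewrite /= inordK yk.
move: wi; rewrite /ext_box enum_rankK (bigD1 j) /= ?jE ?jk ?eqxx// => -[].
by rewrite -ball_normE /= distrC.
Qed.

Definition ext_bound k u d : R :=
  \prod_(j : atom_index ar k.+1) pr (p (tag j)) (ball (u (atom_nat j)) d).

Lemma ext_bound_gt0 k u d : valued A u -> 0 < d -> 0 < ext_bound k u d.
Proof.
move=> Au d0; apply: prodr_gt0 => j _; set x := u _.
have mAx : measurable (A `&` ball x d).
  by apply: measurableI => //; exact: measurable_ball.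
have : (0 < p (tag j) (A `&` ball x d))%E.
  apply: p_full; first exact: ball_open.
  by exists x; split; [exact: Au|exact: ballxx].
rewrite prE// lte_fin => /lt_le_trans; apply; apply: le_pr => //.
exact: measurable_ball.
Qed.

Lemma ext_bound_le1 k u d : ext_bound k u d <= 1.
Proof.
by apply: prodr_ile1 => j _; rewrite pr_ge0 pr_le1//; exact: measurable_ball.
Qed.

Lemma ext_bound_le k n u d (e : k.-tuple 'I_n.+1) b :
  uniq e -> b \notin e -> ext_bound k u d <= Pr n (rect (ext_box u d e b)).
Proof.
move=> ue be; rewrite /rho pr_rect; last exact: measurable_ext_box.
pose h (j : atom_index ar k.+1) := atom_at (rcons e b) (atom_nat j).
have h_inj : injective h.
  by apply: (@atom_at_inj _ _ [tuple of rcons e b]); rewrite /= rcons_uniq be.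
rewrite (reindex enum_rank) /=; last by apply: onW_bij; exact: enum_rank_bij.
under eq_bigr do rewrite enum_rankK.
rewrite (bigID (mem (h @: predT))) /= [X in _ * X]big1 ?mulr1; last first.
  move=> i /negP nhi; rewrite /ext_box big_pred0 ?prT// => j.
  rewrite enum_rankK; apply/negP => /andP[_ /eqP hj].
  by apply: nhi; rewrite -hj imset_f.
rewrite big_imset /=; last by move=> j j' _ _; exact: h_inj.
apply: ler_prod => j _; rewrite pr_ge0 le_pr//; first exact: measurable_ball.
  exact: measurable_ext_box.
move=> x xj; rewrite /ext_box enum_rankK.
by elim/big_ind: _ => // [j' /andP[_ /eqP/h_inj ->]].
Qed.

Definition unextended n k u d (e : k.-tuple 'I_n.+1) : set (points n) :=
  \big[setI/setT]_(b <- [seq b <- enum 'I_n.+1 | b \notin e])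
    ~` rect (ext_box u d e b).

Lemma measurable_unextended n k u d (e : k.-tuple 'I_n.+1) :
  measurable (unextended u d e).
Proof.
by apply: measurable_bigsetI_setC_rect => b c; exact: measurable_ext_box.
Qed.

Lemma pr_unextended_le n k u d (e : k.-tuple 'I_n.+1) : uniq e ->
  Pr n (unextended u d e) <= (1 - ext_bound k u d) ^+ (n.+1 - k).
Proof.
move=> ue; have <- : size [seq b <- enum 'I_n.+1 | b \notin e] = (n.+1 - k)%N.
  have ke : #|e| = k by rewrite (card_uniqP ue) size_tuple.
  by rewrite -[n.+1 in RHS]card_ord -(cardC (mem e)) ke addKn cardE enumT.
apply: pr_setC_rect_le.
- by move=> b c; exact: measurable_ext_box.
- by rewrite filter_uniq// enum_uniq.
- move=> b b'; rewrite mem_filter => /andP[be _] _.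
  exact: ext_box_disjoint_support.
- by move=> b; rewrite mem_filter => /andP[be _]; exact: ext_bound_le.
Qed.

Lemma not_unextended n k u d (w : points n) :
  ~ (\big[setU/set0]_(e : k.-tuple 'I_n.+1 | uniq e) unextended u d e) w ->
  extension_axiom k u d (structure_of w).
Proof.
rewrite -(bigcup_pred (fun e : k.-tuple _ => uniq e)) => nw e ue.
apply: contrapT => noext; apply: nw; exists e => //.
rewrite /unextended -bigcap_seq => b /=; rewrite mem_filter => /andP[be _] wb.
by apply: noext; exists b => // i; exact: rect_ext_box.
Qed.

Lemma almost_all_extension : satisfies_extensions A (almost_all ar p).
Proof.
move=> k u d Au d0; set q := ext_bound k u d.
exists (fun n =>
  \big[setU/set0]_(e : k.-tuple 'I_n.+1 | uniq e) unextended u d e).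
split=> [n|n w|].
- by apply: bigsetU_measurable => e _; exact: measurable_unextended.
- exact: not_unextended.
- have q0 : 0 < q by exact: ext_bound_gt0.
  have q1 : q <= 1 by exact: ext_bound_le1.
  apply: (@squeeze_cvgr _ _ _ _ (fun=> 0)
      (fun n => n.+1%:R ^+ k * (1 - q) ^+ (n.+1 - k))).
  + apply: nearW => n; rewrite pr_ge0 /= (le_trans (pr_bigsetU_le _ _ _ _))//.
      exact: measurable_unextended.
    apply: (le_trans (ler_sum _ (fun e ue => pr_unextended_le u d ue))).
    rewrite sumr_const -[leLHS]mulr_natl ler_wpM2r ?exprn_ge0 ?subr_ge0//.
    by rewrite -natrX ler_nat (leq_trans (max_card _))// card_tuple card_ord.
  + exact: cvg_cst.
  + rewrite (cvg_shiftS (fun n => n%:R ^+ k * (1 - q) ^+ (n - k))).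
    by apply: cvg_polyM_geometric_shift; rewrite ger0_norm; lra.
Qed.

End extension_axioms.

Section almost_sure_values.
Context {R : realType} {Rel : finType} {ar : Rel -> nat}.
Context (A : set R) (mA : measurable A) (p : Rel -> probability R R).
Context (p_carrier : forall r, p r A = 1%E).
Context (neg : R -> R) (A_neg : forall x, A x -> A (neg x)).
Context (neg_continuous : {within A, continuous neg}).
Local Notation points n := (#|atom_index ar n.+1|.-tuple R).
Local Notation Pr n := (pr (rho ar p n.+1)).
Local Notation sentence_value phi :=
  (fun M : structure R ar => value neg (interp M) (fun=> ord0) phi).

Lemma structure_of_valued n (w : points n) :
  structure_valued A (structure_of w) <-> rect (fun=> A) w.
Proof.
split=> [Aw i|Aw r xs]; last exact: Aw.
by rewrite -(enum_valK i); case: (enum_val i) => r xs; exact: Aw.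
Qed.

Lemma pr_carried n : Pr n (rect (fun=> A)) = 1.
Proof. by rewrite /rho pr_rect// big1// => i _; rewrite /pr p_carrier. Qed.

Lemma almost_all_valued : \forall M \near almost_all ar p, structure_valued A M.
Proof.
exists (fun n => ~` rect (fun=> A)); split=> [n|n w /contrapT|].
- by apply: measurableC; exact: measurable_rect.
- by move/structure_of_valued.
- rewrite (_ : (fun n => _) = fun=> 0); first exact: cvg_cst.
  apply/funext => n; rewrite prC ?pr_carried ?subrr//.
  exact: measurable_rect.
Qed.

Lemma measurable_value (neg' : R -> R) n (v : nat -> 'I_n.+1)
    (phi : formula ar) :
  measurable_fun setT neg' ->
  measurable_fun setT (fun w : points n => value neg' (interp_of w) v phi).
Proof.
move=> mneg.
elim: phi v => [r xs|f IHf g IHg|f IHf g IHg|f IHf|x f IHf|x f IHf] v /=.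
- exact: measurable_tnth.
- exact: measurable_minr.
- exact: measurable_maxr.
- exact: measurableT_comp.
- by apply: (measurable_inf_range ord0) => a; exact: IHf.
- by apply: (measurable_sup_range ord0) => a; exact: IHf.
Qed.

Lemma value_patch (M : structure R ar) v phi : structure_valued A M ->
  value (neg \_ A) (interp M) v phi = value neg (interp M) v phi.
Proof.
move=> AM.
elim: phi v => [r xs|f IHf g IHg|f IHf g IHg|f IHf|x f IHf|x f IHf] v //=.
- by rewrite IHf IHg.
- by rewrite IHf IHg.
- by rewrite IHf patchE mem_set//; exact: value_valued.
- by under eq_fun do rewrite IHf.
- by under eq_fun do rewrite IHf.
Qed.

Definition value_event n phi (V : set R) : set (points n) :=
  [set w | (forall i, A (tnth w i)) /\ V (sentence_value phi (structure_of w))].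

(* Off [A] the negation need not be measurable, but its values there are
   irrelevant to the event. *)
Lemma measurable_value_event n (phi : formula ar) (V : set R) : open V ->
  measurable (@value_event n phi V).
Proof.
move=> oV; rewrite (_ : value_event _ _ = rect (fun=> A) `&`
    ((fun w => value (neg \_ A) (interp_of w) (fun=> ord0) phi) @^-1` V)).
  apply: measurableI; first exact: measurable_rect.
  rewrite -[X in measurable X]setTI; apply: measurable_value => //.
    apply: (iffLR (measurable_restrictT _ mA)).
    exact: subspace_continuous_measurable_fun mA neg_continuous.
  exact: open_measurable.
apply/seteqP; split=> w /= [Aw Vw]; split=> //; move: Vw;
  by rewrite /= (@value_patch (structure_of w))//; exact/structure_of_valued.
Qed.

Lemma almost_surelyP (phi : formula ar) (c : R) :
  almost_surely A neg p phi c <->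
  sentence_value phi M @[M --> almost_all ar p] --> c.
Proof.
split=> [phi_c V /=|phi_c V oV Vc].
  rewrite nbhsE => -[U [oU Uc] UV].
  have mU n := @measurable_value_event n phi U oU.
  exists (fun n => ~` value_event phi U); split=> [n|n w /contrapT[_ /UV]//|].
    by apply: measurableC; exact: mU.
  under eq_fun => n do rewrite (prC _ (mU n)).
  rewrite -(subrr 1); apply: cvgB; first exact: cvg_cst.
  exact: fine_cvg (phi_c U oU Uc).
have mV n := @measurable_value_event n phi V oV.
have near_V : almost_all ar p [set M | V (sentence_value phi M)].
  exact: phi_c (open_nbhs_nbhs (conj oV Vc)).
have [E [mE EV PrE0]] := filterI almost_all_valued near_V.
apply: cvg_EFin; first by apply: nearW => n; apply: fin_num_measure; exact: mV.
apply: (@squeeze_cvgr _ _ _ _ (fun n => 1 - Pr n (E n)) (fun=> 1)).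
- apply: nearW => n; apply/andP; split; last by apply: pr_le1; exact: mV.
  rewrite -prC; last exact: mE.
  apply: le_pr; [by apply: measurableC; exact: mE|exact: mV|].
  by move=> w /EV[Aw Vw]; split=> //; exact/structure_of_valued.
- by rewrite -[X in _ --> X](subr0 1); apply: cvgB => //; exact: cvg_cst.
- exact: cvg_cst.
Qed.

End almost_sure_values.

(** * The six constants *)

Section compact_image.
Context {T : topologicalType} {R : realType} (A : set T) (f : T -> R).
Context (A_neq0 : A !=set0) (A_compact : compact A).
Context (f_continuous : {within A, continuous f}).

Lemma sup_image_attained :
  exists u, [/\ A u, sup (f @` A) = f u & forall x, A x -> f x <= f u].
Proof.
have [u uA umax] := compact_EVT_max A_neq0 A_compact f_continuous.
exists u; rewrite inE in uA; split=> // [|x Ax]; last by rewrite umax// inE.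
apply/le_anti/andP; split.
  by apply: ge_sup => [|_ [x Ax <-]]; [exists (f u), u|rewrite umax// inE].
apply: ub_le_sup; last by exists u.
by exists (f u) => _ [x Ax <-]; rewrite umax// inE.
Qed.

Lemma inf_image_attained :
  exists u, [/\ A u, inf (f @` A) = f u & forall x, A x -> f u <= f x].
Proof.
have [u uA umin] := compact_EVT_min A_neq0 A_compact f_continuous.
exists u; rewrite inE in uA; split=> // [|x Ax]; last by rewrite umin// inE.
apply/le_anti/andP; split.
  apply: ge_inf; last by exists u.
  by exists (f u) => _ [x Ax <-]; rewrite umin// inE.
by apply: lb_le_inf => [|_ [x Ax <-]]; [exists (f u), u|rewrite umin// inE].
Qed.

End compact_image.

Lemma map_nseq_tuple (T U : Type) (f : T -> U) m (x : T) :
  map_tuple f (nseq_tuple m x) = nseq_tuple m (f x).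
Proof. by apply: val_inj; rewrite /= map_nseq. Qed.

Section negation.
Context {R : realType} (A : set R) (neg : R -> R).
Context (A01 : A `<=` `[0, 1]) (A_compact : compact A) (A0 : A 0) (A1 : A 1).
Context (A_neg : forall v, A v -> A (neg v)).
Context (neg_continuous : {within A, continuous neg}).
Context (neg_min : forall v w, A v -> A w ->
    neg (Num.min v w) = Num.max (neg v) (neg w)).
Context (neg_max : forall v w, A v -> A w ->
    neg (Num.max v w) = Num.min (neg v) (neg w)).
Context (neg_neg : forall v, A v -> v <= neg (neg v)) (neg1 : neg 1 = 0).

Lemma carrier_bounded x : A x -> 0 <= x <= 1.
Proof. by move=> /A01; rewrite /= in_itv. Qed.

Lemma carrier_min x y : A x -> A y -> A (Num.min x y).
Proof. by case: leP. Qed.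

Lemma carrier_max x y : A x -> A y -> A (Num.max x y).
Proof. by case: leP. Qed.

Lemma carrier_neg_neg x : A x -> A (neg (neg x)).
Proof. by move=> Ax; exact/A_neg/A_neg. Qed.

Lemma neg_antitone x y : A x -> A y -> x <= y -> neg y <= neg x.
Proof.
by move=> Ax Ay /min_idPl xy; rewrite -xy neg_min// le_max lexx orbT.
Qed.

Lemma neg0 : neg 0 = 1.
Proof.
have /carrier_bounded/andP[_ neg0_le1] := A_neg A0.
by apply/le_anti; rewrite neg0_le1 -neg1 neg_neg.
Qed.

Lemma neg3 x : A x -> neg (neg (neg x)) = neg x.
Proof.
move=> Ax; have Ax' := A_neg Ax; apply/le_anti.
by rewrite neg_neg// neg_antitone// ?neg_neg//; exact: A_neg.
Qed.

Lemma iter_negE j x : A x -> iter j neg x =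
  if odd j then neg x else if j == 0%N then x else neg (neg x).
Proof.
move=> Ax; elim: j => [//|[//|j] IH]; rewrite iterS IH /= negbK.
by case: (odd j) => //=; rewrite neg3.
Qed.

Lemma neg_unif_continuous : unif_continuous_on A neg.
Proof. exact: compact_unif_continuous_on. Qed.

Lemma neg_neg_unif_continuous : unif_continuous_on A (neg \o neg).
Proof.
exact: unif_continuous_on_comp A_neg neg_unif_continuous neg_unif_continuous.
Qed.

Lemma neg_sup_image f : unif_continuous_on A f -> (forall x, A x -> A (f x)) ->
  neg (sup (f @` A)) = inf ((neg \o f) @` A).
Proof.
move=> uf Af; have Aneq0 : A !=set0 by exists 0.
have unf : unif_continuous_on A (neg \o f).
  exact: unif_continuous_on_comp Af neg_unif_continuous uf.
have [u [Au -> umax]] :=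
  sup_image_attained Aneq0 A_compact (unif_continuous_on_within uf).
have [v [Av -> vmin]] :=
  inf_image_attained Aneq0 A_compact (unif_continuous_on_within unf).
apply/le_anti; rewrite [X in _ && X](vmin u)// andbT.
by apply: neg_antitone; [exact: Af..|exact: umax].
Qed.

Lemma neg_inf_image f : unif_continuous_on A f -> (forall x, A x -> A (f x)) ->
  neg (inf (f @` A)) = sup ((neg \o f) @` A).
Proof.
move=> uf Af; have Aneq0 : A !=set0 by exists 0.
have unf : unif_continuous_on A (neg \o f).
  exact: unif_continuous_on_comp Af neg_unif_continuous uf.
have [u [Au -> umin]] :=
  inf_image_attained Aneq0 A_compact (unif_continuous_on_within uf).
have [v [Av -> vmax]] :=
  sup_image_attained Aneq0 A_compact (unif_continuous_on_within unf).
apply/le_anti; rewrite (vmax u)//=.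
by apply: neg_antitone; [exact: Af..|exact: umin].
Qed.

Definition epsilon : R := sup [set Num.min x (neg x) | x in A].
Definition epsilon' : R := sup [set Num.min (neg x) (neg (neg x)) | x in A].
Definition delta : R := inf [set Num.max x (neg x) | x in A].
Definition delta' : R := inf [set Num.max (neg x) (neg (neg x)) | x in A].

Definition listed : set R :=
  [set a | [\/ a = 0, a = 1 | a = epsilon] \/
           [\/ a = epsilon', a = delta | a = delta']].

Lemma meet_neg_unif_continuous :
  unif_continuous_on A (fun x => Num.min x (neg x)).
Proof.
exact: (unif_continuous_on_min (@unif_continuous_on_id _ _ A)
  neg_unif_continuous).
Qed.

Lemma meet_neg_neg_unif_continuous :
  unif_continuous_on A (fun x => Num.min (neg x) (neg (neg x))).
Proof.
exact: unif_continuous_on_min neg_unif_continuous neg_neg_unif_continuous.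
Qed.

Lemma join_neg_unif_continuous :
  unif_continuous_on A (fun x => Num.max x (neg x)).
Proof.
exact: (unif_continuous_on_max (@unif_continuous_on_id _ _ A)
  neg_unif_continuous).
Qed.

Lemma join_neg_neg_unif_continuous :
  unif_continuous_on A (fun x => Num.max (neg x) (neg (neg x))).
Proof.
exact: unif_continuous_on_max neg_unif_continuous neg_neg_unif_continuous.
Qed.

Lemma epsilon_attained : exists u, [/\ A u, epsilon = Num.min u (neg u) &
  forall x, A x -> Num.min x (neg x) <= Num.min u (neg u)].
Proof.
apply: (sup_image_attained _ A_compact); first by exists 0.
exact: unif_continuous_on_within meet_neg_unif_continuous.
Qed.

Lemma epsilon'_attained : exists u,
  [/\ A u, epsilon' = Num.min (neg u) (neg (neg u)) &
  forall x, A x ->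
    Num.min (neg x) (neg (neg x)) <= Num.min (neg u) (neg (neg u))].
Proof.
apply: (sup_image_attained _ A_compact); first by exists 0.
exact: unif_continuous_on_within meet_neg_neg_unif_continuous.
Qed.

Lemma delta_attained : exists u, [/\ A u, delta = Num.max u (neg u) &
  forall x, A x -> Num.max u (neg u) <= Num.max x (neg x)].
Proof.
apply: (inf_image_attained _ A_compact); first by exists 0.
exact: unif_continuous_on_within join_neg_unif_continuous.
Qed.

Lemma delta'_attained : exists u,
  [/\ A u, delta' = Num.max (neg u) (neg (neg u)) &
  forall x, A x ->
    Num.max (neg u) (neg (neg u)) <= Num.max (neg x) (neg (neg x))].
Proof.
apply: (inf_image_attained _ A_compact); first by exists 0.
exact: unif_continuous_on_within join_neg_neg_unif_continuous.
Qed.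

Lemma listed_sub_carrier : listed `<=` A.
Proof.
move=> a [[->//|->//|->]|[->|->|->]].
- have [u [Au -> _]] := epsilon_attained.
  by apply: carrier_min => //; exact: A_neg.
- have [u [Au -> _]] := epsilon'_attained.
  by apply: carrier_min; [exact: A_neg|exact: carrier_neg_neg].
- have [u [Au -> _]] := delta_attained.
  by apply: carrier_max => //; exact: A_neg.
- have [u [Au -> _]] := delta'_attained.
  by apply: carrier_max; [exact: A_neg|exact: carrier_neg_neg].
Qed.

Lemma listed0 : listed 0. Proof. by left; constructor 1. Qed.
Lemma listed1 : listed 1. Proof. by left; constructor 2. Qed.
Lemma listed_epsilon : listed epsilon. Proof. by left; constructor 3. Qed.
Lemma listed_epsilon' : listed epsilon'. Proof. by right; constructor 1. Qed.
Lemma listed_delta : listed delta. Proof. by right; constructor 2. Qed.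
Lemma listed_delta' : listed delta'. Proof. by right; constructor 3. Qed.

Lemma neg_epsilon : neg epsilon = delta'.
Proof.
rewrite [LHS]neg_sup_image.
- by congr inf; apply: eq_imagel => x Ax /=; rewrite neg_min//; exact: A_neg.
- exact: meet_neg_unif_continuous.
- by move=> x Ax; apply: carrier_min => //; exact: A_neg.
Qed.

Lemma neg_epsilon' : neg epsilon' = delta'.
Proof.
rewrite [LHS]neg_sup_image.
- congr inf; apply: eq_imagel => x Ax /=.
  by rewrite neg_min ?neg3 1?maxC//; [exact: A_neg|exact: carrier_neg_neg].
- exact: meet_neg_neg_unif_continuous.
- by move=> x Ax; apply: carrier_min; [exact: A_neg|exact: carrier_neg_neg].
Qed.

Lemma neg_delta : neg delta = epsilon'.
Proof.
rewrite [LHS]neg_inf_image.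
- by congr sup; apply: eq_imagel => x Ax /=; rewrite neg_max//; exact: A_neg.
- exact: join_neg_unif_continuous.
- by move=> x Ax; apply: carrier_max => //; exact: A_neg.
Qed.

Lemma neg_delta' : neg delta' = epsilon'.
Proof.
rewrite [LHS]neg_inf_image.
- congr sup; apply: eq_imagel => x Ax /=.
  by rewrite neg_max ?neg3 1?minC//; [exact: A_neg|exact: carrier_neg_neg].
- exact: join_neg_neg_unif_continuous.
- by move=> x Ax; apply: carrier_max; [exact: A_neg|exact: carrier_neg_neg].
Qed.

Lemma listed_neg a : listed a -> listed (neg a).
Proof.
move=> [[->|->|->]|[->|->|->]].
- by rewrite neg0; exact: listed1.
- by rewrite neg1; exact: listed0.
- by rewrite neg_epsilon; exact: listed_delta'.
- by rewrite neg_epsilon'; exact: listed_delta'.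
- by rewrite neg_delta; exact: listed_epsilon'.
- by rewrite neg_delta'; exact: listed_epsilon'.
Qed.

(* A meet of iterates of [neg] at [x] reduces to at most two of [x], [neg x],
   [neg (neg x)], because [x <= neg (neg x)]; without an odd iterate, or with
   odd ones only, it takes the value [1]. *)
Lemma listed_meet_attained (js : seq nat) :
  meet_attained A listed (fun j x => iter j neg x) js.
Proof.
have listed_le1 c : listed c -> c <= 1.
  by move=> /listed_sub_carrier/carrier_bounded/andP[].
have [/hasP[i ijs i_odd]|/hasPn no_odd] := boolP (has odd js); last first.
  apply: (meet_attained_top listed_le1 A1) => j /no_odd/negbTE j_even.
  by rewrite iter_negE// j_even neg1 neg0; case: ifP.
have [js0|js0] := boolP (0%N \in js).
  have [u [Au uE umax]] := epsilon_attained.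
  apply: (meet_attained_pair (u := u) js0 ijs) => // [x Ax j _||x Ax].
  - rewrite !iter_negE// i_odd /= ge_min; case: ifP; rewrite ?lexx ?orbT// => _.
    by case: ifP; rewrite ?lexx// neg_neg.
  - by rewrite !iter_negE// i_odd /= -uE; exact: listed_epsilon.
  - by rewrite !iter_negE// i_odd /= umax.
have [/hasP[k kjs k_even]|/hasPn all_odd] := boolP (has (predC odd) js).
  have iterE x j : A x -> j \in js ->
      iter j neg x = if odd j then neg x else neg (neg x).
    move=> Ax jjs; rewrite iter_negE//; case: eqP => // j0.
    by rewrite -j0 jjs in js0.
  have [u [Au uE umax]] := epsilon'_attained.
  apply: (meet_attained_pair (u := u) ijs kjs) => // [x Ax j jjs||x Ax].
  - rewrite !iterE// i_odd (negbTE k_even) ge_min.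
    by case: ifP; rewrite lexx ?orbT.
  - by rewrite !iterE// i_odd (negbTE k_even) -uE; exact: listed_epsilon'.
  - by rewrite !iterE// i_odd (negbTE k_even) umax.
apply: (meet_attained_top listed_le1 A0) => j /all_odd /negPn j_odd.
by rewrite iter_negE// j_odd neg0.
Qed.

Lemma listed_join_attained (js : seq nat) :
  meet_attained A (-%R @` listed) (fun j x => - iter j neg x) js.
Proof.
have N_le0 c : (-%R @` listed) c -> c <= 0.
  move=> [a /listed_sub_carrier/carrier_bounded/andP[a0 _] <-].
  by rewrite oppr_le0.
have [/hasP[i ijs i_odd]|/hasPn no_odd] := boolP (has odd js); last first.
  apply: (meet_attained_top N_le0 A0) => j /no_odd/negbTE j_even.
  by rewrite iter_negE// j_even neg0 neg1; case: ifP; rewrite oppr0.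
have [/hasP[k kjs /andP[k_even k0]]|/hasPn no_even] :=
    boolP (has (fun j => ~~ odd j && (j != 0%N)) js).
  have [u [Au uE umin]] := delta'_attained.
  apply: (meet_attained_pair (u := u) ijs kjs) => // [x Ax j jjs||x Ax].
  - rewrite !iter_negE// i_odd (negbTE k_even) (negbTE k0) /= -oppr_max.
    rewrite lerN2 le_max.
    by case: ifP; rewrite ?lexx// => _; case: ifP; rewrite ?neg_neg ?lexx ?orbT.
  - rewrite !iter_negE// i_odd (negbTE k_even) (negbTE k0) /= -oppr_max -uE.
    by exists delta' => //; exact: listed_delta'.
  - rewrite !iter_negE// i_odd (negbTE k_even) (negbTE k0) /= -!oppr_max.
    by rewrite lerN2 umin.
have iterE x j : A x -> j \in js -> iter j neg x = if odd j then neg x else x.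
  move=> Ax jjs; rewrite iter_negE//; case: ifP => // j_odd.
  case: eqP => // /eqP j0.
  by have := no_even j jjs; rewrite j_odd j0.
have [js0|js0] := boolP (0%N \in js).
  have [u [Au uE umin]] := delta_attained.
  apply: (meet_attained_pair (u := u) js0 ijs) => // [x Ax j jjs||x Ax].
  - rewrite !iterE// i_odd /= -oppr_max lerN2 le_max.
    by case: ifP; rewrite lexx ?orbT.
  - rewrite !iterE// i_odd /= -oppr_max -uE.
    by exists delta => //; exact: listed_delta.
  - by rewrite !iterE// i_odd /= -!oppr_max lerN2 umin.
apply: (meet_attained_top N_le0 A1) => j jjs; rewrite iterE//.
have [_|j_even] := boolP (odd j); first by rewrite neg1 oppr0.
have := no_even j jjs; rewrite j_even /= negbK => /eqP j0.
by rewrite -j0 jjs in js0.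
Qed.

Section limits.
Context {Rel : finType} {ar : Rel -> nat} (ar_gt0 : forall r, (0 < ar r)%N).
Local Notation structure := (structure R ar).
Context (F : set_system structure) {FF : Filter F}.
Context (near_valued : \forall M \near F, structure_valued A M).
Context (near_extension : satisfies_extensions A F).

Definition sentence_limit (phi : formula ar) (c : R) :=
  sentence phi /\ value neg (interp M) (fun=> ord0) phi @[M --> F] --> c.

Lemma sentence_limit_listed (phi : formula ar) : sentence phi ->
  exists2 c, listed c & sentence_limit phi c.
Proof.
move=> phi_closed; have [c Kc phi_c] := value_sentence_cvg near_valued
  near_extension carrier_bounded listed_sub_carrier listed0 listed1 A_neg
  listed_neg neg_unif_continuous neg_min neg_max listed_meet_attained
  listed_join_attained ar_gt0 phi_closed.
by exists c.
Qed.

Section diagonal.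
Variable r : Rel.

Definition diag (M : structure) (b : 'I_(dom M).+1) : R :=
  interp M r (nseq_tuple (ar r) b).

Lemma near_diag u (d : R) : A u -> 0 < d ->
  \forall M \near F, exists b : 'I_(dom M).+1, `|diag b - u| < d.
Proof.
move=> Au d0; have := near_extension 0 (fun=> Au) d0.
apply: filterS => M /(_ [tuple] isT)[b _ bP]; exists b.
have := bP (existT _ r (nseq_tuple (ar r) 0%N)).
rewrite /level /diagram /= map_nseq_tuple /= !all_nseq /= orbT orbF -lt0n.
exact.
Qed.

Lemma sup_diag_cvg (g : R -> R) u : unif_continuous_on A g -> A u ->
  (forall x, A x -> g x <= g u) ->
  sup (range (fun b => g (diag (M := M) b))) @[M --> F] --> g u.
Proof.
move=> ug Au umax; apply/cvgrPdist_le => e /ug[d d0 gP].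
apply: filterS2 near_valued (near_diag Au d0) => M AM [b bu].
have [c [-> cmax]] := sup_range_fin ord0 (fun b : 'I_(dom M).+1 => g (diag b)).
have Adiag (a : 'I_(dom M).+1) : A (diag a) by exact: AM.
have := gP _ _ (Adiag b) Au bu; rewrite ltr_distl => /andP[gb _].
have := umax _ (Adiag c); have := cmax b; rewrite ler_distl => ? ?.
by apply/andP; split; lra.
Qed.

Lemma inf_diag_cvg (g : R -> R) u : unif_continuous_on A g -> A u ->
  (forall x, A x -> g u <= g x) ->
  inf (range (fun b => g (diag (M := M) b))) @[M --> F] --> g u.
Proof.
move=> ug Au umin; under eq_fun do rewrite inf_imageE.
rewrite -[g u]opprK; apply: cvgN.
apply: (sup_diag_cvg (g := fun x => - g x)) => //.
  exact: unif_continuous_onN.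
by move=> x Ax; rewrite lerN2 umin.
Qed.

Definition diagonal (phi : formula ar) (g : R -> R) :=
  all (pred1 0%N) (free_vars phi) /\
  forall (M : structure) v, value neg (interp M) v phi = g (diag (v 0%N)).

Lemma diagonal_atom : diagonal (Atom (nseq_tuple (ar r) 0%N)) id.
Proof.
by split=> [|M v]; [rewrite /= all_nseq orbT|rewrite /= map_nseq_tuple].
Qed.

Lemma diagonal_neg phi g : diagonal phi g ->
  diagonal (Neg phi) (fun x => neg (g x)).
Proof. by move=> [fv0 phiE]; split=> // M v /=; rewrite phiE. Qed.

Lemma diagonal_and phi psi g h : diagonal phi g -> diagonal psi h ->
  diagonal (And phi psi) (fun x => Num.min (g x) (h x)).
Proof.
move=> [fv0 phiE] [fv0' psiE]; split=> [|M v /=]; last by rewrite phiE psiE.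
by rewrite /= all_cat fv0.
Qed.

Lemma diagonal_or phi psi g h : diagonal phi g -> diagonal psi h ->
  diagonal (Or phi psi) (fun x => Num.max (g x) (h x)).
Proof.
move=> [fv0 phiE] [fv0' psiE]; split=> [|M v /=]; last by rewrite phiE psiE.
by rewrite /= all_cat fv0.
Qed.

Lemma diagonal_closed phi g : diagonal phi g ->
  [seq y <- free_vars phi | y != 0%N] = [::].
Proof.
move=> [/allP fv0 _]; apply/eqP; rewrite -[_ == _]negbK -has_filter.
by apply/hasPn => y /fv0 /= ->.
Qed.

Lemma exists_diagonal_limit phi g u : diagonal phi g ->
  unif_continuous_on A g -> A u -> (forall x, A x -> g x <= g u) ->
  sentence_limit (Exists 0 phi) (g u).
Proof.
move=> phi_g ug Au umax; split; first exact: diagonal_closed phi_g.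
rewrite (_ : (fun M => _) =
    (fun M => sup (range (fun b => g (diag (M := M) b))))).
  exact: sup_diag_cvg.
apply/funext => M /=; congr sup; apply: eq_imagel => b _.
by have [_ ->] := phi_g.
Qed.

Lemma forall_diagonal_limit phi g u : diagonal phi g ->
  unif_continuous_on A g -> A u -> (forall x, A x -> g u <= g x) ->
  sentence_limit (Forall 0 phi) (g u).
Proof.
move=> phi_g ug Au umin; split; first exact: diagonal_closed phi_g.
rewrite (_ : (fun M => _) =
    (fun M => inf (range (fun b => g (diag (M := M) b))))).
  exact: inf_diag_cvg.
apply/funext => M /=; congr inf; apply: eq_imagel => b _.
by have [_ ->] := phi_g.
Qed.

Lemma listed_sentence_limit a : listed a -> exists phi, sentence_limit phi a.
Proof.
have P := diagonal_atom; have NP := diagonal_neg P; have NNP := diagonal_neg NP.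
have id_unif := @unif_continuous_on_id R R A.
move=> [[->|->|->]|[->|->|->]].
- eexists; apply: (forall_diagonal_limit P id_unif A0) => x.
  by move=> /carrier_bounded/andP[].
- eexists; apply: (exists_diagonal_limit P id_unif A1) => x.
  by move=> /carrier_bounded/andP[].
- have [u [Au -> umax]] := epsilon_attained; eexists.
  exact: exists_diagonal_limit
    (diagonal_and P NP) meet_neg_unif_continuous Au umax.
- have [u [Au -> umax]] := epsilon'_attained; eexists.
  exact: exists_diagonal_limit
    (diagonal_and NP NNP) meet_neg_neg_unif_continuous Au umax.
- have [u [Au -> umin]] := delta_attained; eexists.
  exact: forall_diagonal_limit
    (diagonal_or P NP) join_neg_unif_continuous Au umin.
- have [u [Au -> umin]] := delta'_attained; eexists.
  exact: forall_diagonal_limit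
    (diagonal_or NP NNP) join_neg_neg_unif_continuous Au umin.
Qed.

End diagonal.

End limits.

End negation.

Theorem theorem6p6 (R : realType) (A : set R) (neg : R -> R)
  (A01 : A `<=` `[0, 1]) (A_infinite : infinite_set A) (A_compact : compact A)
  (A0 : A 0) (A1 : A 1)
  (A_min : forall v w, A v -> A w -> A (Num.min v w))
  (A_max : forall v w, A v -> A w -> A (Num.max v w))
  (A_neg : forall v, A v -> A (neg v))
  (neg_continuous : {within A, continuous neg})
  (neg_min : forall v w, A v -> A w ->
    neg (Num.min v w) = Num.max (neg v) (neg w))
  (neg_max : forall v w, A v -> A w ->
    neg (Num.max v w) = Num.min (neg v) (neg w))
  (neg_neg : forall v, A v -> v <= neg (neg v))
  (neg1 : neg 1 = 0)
  (Rel : finType) (ar : Rel -> nat) (ar_gt0 : forall r, (0 < ar r)%N)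
  (p : Rel -> probability R R)
  (p_carrier : forall r, p r A = 1%E)
  (p_full : forall r (U : set R), open U -> A `&` U !=set0 ->
    (0 < p r (A `&` U))%E) :
  let epsilon := sup [set Num.min x (neg x) | x in A] in
  let epsilon' := sup [set Num.min (neg x) (neg (neg x)) | x in A] in
  let delta := inf [set Num.max x (neg x) | x in A] in
  let delta' := inf [set Num.max (neg x) (neg (neg x)) | x in A] in
  let is_listed (a : R) := [\/ a = 0, a = 1 | a = epsilon] \/
                           [\/ a = epsilon', a = delta | a = delta'] in
  [/\ zero_one_law ar A neg p,
      forall a, almost_sure_value ar A neg p a -> is_listed a &
      (0 < #|Rel|)%N ->
        forall a, is_listed a -> almost_sure_value ar A neg p a].
Proof.
move=> epsilon epsilon' delta delta' is_listed.
have mA : measurable A := compact_measurable A_compact.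
have near_valued := almost_all_valued (ar := ar) mA p_carrier.
have near_extension := almost_all_extension (ar := ar) mA p_full.
have asP (phi : formula ar) :=
  almost_surelyP mA p_carrier A_neg neg_continuous phi.
have as_unique (phi : formula ar) c c' : almost_surely A neg p phi c ->
    almost_surely A neg p phi c' -> c = c'.
  by move=> /asP phi_c /asP phi_c'; exact: cvg_unique phi_c phi_c'.
have listedA : listed A neg `<=` A by exact: listed_sub_carrier.
have as_listed (phi : formula ar) : sentence phi ->
    exists2 c, listed A neg c & almost_surely A neg p phi c.
  move=> phi_closed; have [c Kc [_ /asP phi_c]] : exists2 c, listed A neg c &
    sentence_limit neg (almost_all ar p) phi c by exact: sentence_limit_listed.
  by exists c.
split=> [phi /as_listed[c Kc phi_c]|a [_ [phi /as_listed[c Kc phi_c] phi_a]]|].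
- exists c; split=> [|c' [_ phi_c']]; first by split=> //; exact: listedA.
  exact: as_unique phi_c phi_c'.
- by rewrite (as_unique _ _ _ phi_a phi_c); exact: Kc.
- move=> /card_gt0P[r _] a Ka; split; first exact: listedA.
  have [phi [phi_closed /asP phi_a]] :
    exists phi, sentence_limit neg (almost_all ar p) phi a.
    exact: listed_sentence_limit Ka.
  by exists phi.
Qed.
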